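(* Let $F=\frac1n\sum_{i=1}^nf_i:\mathbb R^d\to\mathbb R$ satisfy the third-moment smoothness assumption with constant $L_2>0$ and initial gap $\Delta>0$ (defined in the context), and let $\varepsilon>0$. Let $M=C_ML_2$ for $C_M=150$. Let the epoch length be $T=\max\{2,n^{1/5}\}$ and the number of epochs $S=\max\{1,\,240\,C_M^2L_2^{1/2}\Delta\,n^{-1/5}\varepsilon^{-3/2}\}$. Set the batch sizes to $b_g=5\max\{n^{4/5},2^4\}$ and $b_h=3000\max\{4,n^{2/5}\}\log^3d$. Then the algorithm SVRC (given in the context), run with these parameters from $\mathbf x_0=\mathbf 0$, needs $$\tilde{\mathcal O}\left(n+\frac{\Delta\sqrt{L_2}\,n^{4/5}}{\varepsilon^{3/2}}\right)$$ oracle queries to find a point $\mathbf x_{\mathrm{out}}$ such that $$\mathbb E\left[\max\left\{\|\nabla F(\mathbf x_{\mathrm{out}})\|^{3/2},\ -\frac{\lambda_{\min}^3(\nabla^2F(\mathbf x_{\mathrm{out}}))}{L_2^{3/2}}\right\}\right]\le\varepsilon^{3/2}.$$ In particular, $\mathbb E\|\nabla F(\mathbf x_{\mathrm{out}})\|\le\varepsilon$.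
   Context: $\|\cdot\|$ is the Euclidean norm for vectors and the spectral norm for matrices; $\lambda_{\min}$ is the smallest eigenvalue; $\log$ is the natural logarithm; $[m]=\{1,\dots,m\}$; the dimension is $d\ge2$. As in the paper, integer rounding of the parameters $T,S,b_g,b_h$ is ignored. Third-moment smoothness assumption with constant $L_2$: $F=\frac1n\sum_{i=1}^nf_i$ with twice continuously differentiable $f_i:\mathbb R^d\to\mathbb R$, such that for all $\mathbf x,\mathbf y\in\mathbb R^d$, $\left(\mathbb E_i\|\nabla^2f_i(\mathbf x)-\nabla^2f_i(\mathbf y)\|^3\right)^{1/3}\le L_2\|\mathbf x-\mathbf y\|$, where $\mathbb E_i$ is the expectation over $i$ uniform on $[n]$; moreover $F(\mathbf x_0)-\inf_{\mathbf x}F(\mathbf x)\le\Delta$ with starting point $\mathbf x_0=\mathbf 0$. An oracle query consists of an index $i\in[n]$ and a point $\mathbf x$, and returns $f_i(\mathbf x),\nabla f_i(\mathbf x),\nabla^2f_i(\mathbf x)$. $\tilde{\mathcal O}$ hides constants and factors polylogarithmic in $d$, $n$ and $1/\varepsilon$. Algorithm SVRC. Input: gradient and Hessian batch sizes $b_g,b_h$, cubic penalty parameter $M$, number of epochs $S$, steps per epoch $T$, starting point $\mathbf x_0$. Set $\widehat{\mathbf x}^1=\mathbf x_0$. For $s=1,\dots,S$: set $\mathbf x_0^s=\widehat{\mathbf x}^s$, $\mathbf g^s=\nabla F(\widehat{\mathbf x}^s)$, $\mathbf H^s=\nabla^2F(\widehat{\mathbf x}^s)$; for $t=0,\dots,T-1$: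 sample batches $I_g,I_h$ of indices from $[n]$ (independent uniform draws) with $|I_g|=b_g$, $|I_h|=b_h$, and set $$\mathbf v_t^s=\frac1{b_g}\sum_{i\in I_g}[\nabla f_i(\mathbf x_t^s)-\nabla f_i(\widehat{\mathbf x}^s)]+\mathbf g^s-\Big(\frac1{b_g}\sum_{i\in I_g}\nabla^2f_i(\widehat{\mathbf x}^s)-\mathbf H^s\Big)(\mathbf x_t^s-\widehat{\mathbf x}^s),$$ $$\mathbf U_t^s=\frac1{b_h}\sum_{j\in I_h}[\nabla^2f_j(\mathbf x_t^s)-\nabla^2f_j(\widehat{\mathbf x}^s)]+\mathbf H^s,$$ $$\mathbf h_t^s=\arg\min_{\mathbf h}\Big[\langle\mathbf v_t^s,\mathbf h\rangle+\tfrac12\langle\mathbf U_t^s\mathbf h,\mathbf h\rangle+\tfrac M6\|\mathbf h\|^3\Big],\qquad \mathbf x_{t+1}^s=\mathbf x_t^s+\mathbf h_t^s;$$ after the inner loop set $\widehat{\mathbf x}^{s+1}=\mathbf x_T^s$. Output: $\mathbf x_{\mathrm{out}}=\mathbf x_t^s$ with $s\in[S]$, $t\in[T]$ chosen uniformly at random. *)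

(* Defs.v *)
From HB Require Import structures.
From mathcomp Require Import all_boot all_order all_algebra.
From mathcomp Require Import all_classical all_reals all_analysis.

Set Implicit Arguments.
Unset Strict Implicit.
Unset Printing Implicit Defensive.

Import Order.TTheory GRing.Theory Num.Theory.
Import numFieldNormedType.Exports.

Local Open Scope classical_set_scope.
Local Open Scope ring_scope.

(* Points of R^d are row vectors and a matrix A acts by u |-> u *m A.  This is
   the library's convention for 'J and [eigenvalue]; it makes no difference for
   Hessians of C^2 functions, which are symmetric. *)

Section LinearAlgebra.
Context {R : realType} {d : nat}.

Definition dotv (u v : 'rV[R]_d) : R := \sum_i u 0 i * v 0 i.

(* The library norm `|u| on 'rV[R]_d is the sup norm, hence this definition. *)
Definition enorm (u : 'rV[R]_d) : R := Num.sqrt (dotv u u).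

Definition spectral_norm (A : 'M[R]_d) : R :=
  sup [set enorm (u *m A) | u in [set u | enorm u <= 1]].

(* For a symmetric A and d > 0 the set of eigenvalues is finite and nonempty,
   so that the infimum is a minimum. *)
Definition lambda_min (A : 'M[R]_d) : R := inf [set a | eigenvalue A a].

End LinearAlgebra.

Section Calculus.
Context {R : realType} {d : nat}.

Definition grad (f : 'rV[R]_d -> R) (x : 'rV[R]_d) : 'rV[R]_d :=
  \row_j 'D_(delta_mx 0 j) f x.

Definition hess (f : 'rV[R]_d -> R) (x : 'rV[R]_d) : 'M[R]_d := 'J (grad f) x.

Definition twice_continuously_differentiable (f : 'rV[R]_d -> R) : Prop :=
  [/\ forall x, differentiable f x,
      forall x, differentiable (grad f) x
    & continuous (hess f)].

End Calculus.

(* Expectation under the uniform distribution on a finite type. *)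
Definition mean {R : realType} {T : finType} (X : T -> R) : R :=
  (\sum_w X w) / #|T|%:R.

Section FiniteSum.
Context {R : realType} {d n : nat} (f : 'I_n -> 'rV[R]_d -> R).

Definition objective (x : 'rV[R]_d) : R := mean (f ^~ x).

Definition third_moment_smooth (L2 : R) : Prop :=
  (forall i, twice_continuously_differentiable (f i)) /\
  forall x y,
    mean (fun i => spectral_norm (hess (f i) x - hess (f i) y) ^+ 3) `^ (1 / 3)
    <= L2 * enorm (x - y).

(* The infimum is taken in \bar R, so the bound forces the objective to be
   bounded below. *)
Definition initial_gap (x0 : 'rV[R]_d) (Delta : R) : Prop :=
  ((objective x0)%:E - ereal_inf (range (fun x => (objective x)%:E))
   <= Delta%:E)%E.

End FiniteSum.

Section SVRC.
Context {R : realType} {d n : nat} (f : 'I_n -> 'rV[R]_d -> R).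

Local Notation F := (objective f).

Section Estimators.
Variables (xhat x : 'rV[R]_d).

Definition grad_estimator {b : nat} (I : b.-tuple 'I_n) : 'rV[R]_d :=
  b%:R^-1 *: (\sum_(i <- I) (grad (f i) x - grad (f i) xhat)) + grad F xhat
  - (x - xhat) *m (b%:R^-1 *: (\sum_(i <- I) hess (f i) xhat) - hess F xhat).

Definition hess_estimator {b : nat} (J : b.-tuple 'I_n) : 'M[R]_d :=
  b%:R^-1 *: (\sum_(j <- J) (hess (f j) x - hess (f j) xhat)) + hess F xhat.

End Estimators.

Definition cubic_model (M : R) (v : 'rV[R]_d) (U : 'M[R]_d) (h : 'rV[R]_d) : R :=
  dotv v h + 1 / 2 * dotv (h *m U) h + M / 6 * enorm h ^+ 3.

Definition cubic_argmin (M : R) (v : 'rV[R]_d) (U : 'M[R]_d) (h : 'rV[R]_d)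
    : Prop :=
  forall h', cubic_model M v U h <= cubic_model M v U h'.

Section Run.
Variables (S T bg bh : nat).

(* All batches drawn during a run: w (s, t) = (I_g, I_h), with epochs numbered
   0, ..., S - 1.  The uniform distribution on this finite type makes all the
   indices independent and uniform on 'I_n (drawn with replacement). *)
Definition batches : finType :=
  {ffun 'I_S * 'I_T -> bg.-tuple 'I_n * bh.-tuple 'I_n}.

Definition same_past (s t : nat) (w w' : batches) : Prop :=
  forall (s' : 'I_S) (t' : 'I_T),
    (s' < s)%N || (s' == s :> nat) && (t' < t)%N -> w (s', t') = w' (s', t').

(* x w s t is the iterate x_t^s when the batches are w, and x w s 0 is the
   snapshot of epoch s.  A cubic subproblem may have several minimizers: ties
   are broken in any way that depends only on the batches drawn so far. *)
Definition SVRC_run (M : R) (x0 : 'rV[R]_d)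
    (x : batches -> nat -> nat -> 'rV[R]_d) : Prop :=
  [/\ forall w, x w 0%N 0%N = x0,
      forall w (s : nat), (s.+1 < S)%N -> x w s.+1 0%N = x w s T,
      forall w (s : 'I_S) (t : 'I_T),
        cubic_argmin M
          (grad_estimator (x w s 0%N) (x w s t) (w (s, t)).1)
          (hess_estimator (x w s 0%N) (x w s t) (w (s, t)).2)
          (x w s t.+1 - x w s t)
    & forall w w' (s t : nat), (s < S)%N -> (t <= T)%N ->
        same_past s t w w' -> x w s t = x w' s t].

(* The queries (i, y) of a run: a full pass at each snapshot, then in each
   inner step both the current iterate and the snapshot for every sampled
   index (answers from the full pass are not reused). *)
Definition oracle_queries (x : batches -> nat -> nat -> 'rV[R]_d) (w : batches)
    : seq ('I_n * 'rV[R]_d) :=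
  flatten [seq
    [seq (i, x w s 0%N) | i <- enum 'I_n] ++
    flatten [seq
      [seq (i, x w s t) | i <- (w (s, t)).1] ++
      [seq (i, x w s 0%N) | i <- (w (s, t)).1] ++
      [seq (j, x w s t) | j <- (w (s, t)).2] ++
      [seq (j, x w s 0%N) | j <- (w (s, t)).2]
    | t : 'I_T]
  | s : 'I_S].

(* Expectation of phi at the output: over the batches and over the uniform
   choice of x_t^s with t = 1, ..., T. *)
Definition expect_out (x : batches -> nat -> nat -> 'rV[R]_d)
    (phi : 'rV[R]_d -> R) : R :=
  mean (fun o : batches * ('I_S * 'I_T) => phi (x o.1 o.2.1 o.2.2.+1)).

End Run.
End SVRC.

Arguments batches n S T bg bh : clear implicits.

(* k is x rounded to an integer, up or down. *)
Definition rounding {R : realType} (k : nat) (x : R) : Prop :=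
  k%:Z = Num.floor x \/ k%:Z = Num.ceil x.

(* ln (1 + eps^-1) rather than ln (eps^-1): the latter is negative for
   eps > 1. *)
Definition log_factor {R : realType} (d n : nat) (eps : R) : R :=
  (1 + ln d%:R) * (1 + ln n%:R) * (1 + ln (1 + eps^-1)).

(* Main.v *)
(* Three facts drive the proof. (1) A global minimizer h of the cubic model with
   gradient v and symmetric Hessian U satisfies v + U h + M/2 |h| h = 0 and
   U + M/2 |h| >= 0, hence decreases the model by M/12 |h|^3. Consequently F
   decreases by a multiple of L |h|^3, and both |grad F|^(3/2) and the cube of
   the negative curvature at the next point are at most multiples of |h|^3, up
   to the errors of v and U. (2) With r the distance to the snapshot, the
   gradient error has second moment at most (L/2 r^2)^2 / b_g, and the Hessian
   error has third moment O((k/b_h)^(3/2) (L r)^3) for any k > 1 with d <= 4^k.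
   For the latter, symmetrize and expand the trace of the 2k-th power of a
   Rademacher sum of matrices into words: all words carry nonnegative weights,
   so norms reduce the estimate to the scalar Khintchine inequality at the cost
   of a factor d. (3) Along an epoch of length T, sum_t (r_t / T)^3 is at most
   sum_t |h_t|^3, so the batch sizes make the errors absorbable into the
   decrease. Telescoping bounds the total expected |h|^3 by a multiple of
   Delta / L. *)

Require Import Defs.
From mathcomp Require Import all_boot all_order all_algebra.
From mathcomp Require Import all_classical all_reals all_analysis.
From mathcomp Require Import ring lra.

Set Implicit Arguments.
Unset Strict Implicit.
Unset Printing Implicit Defensive.

Import Order.TTheory GRing.Theory Num.Theory.
Import numFieldNormedType.Exports.

Local Open Scope classical_set_scope.
Local Open Scope ring_scope.

(** The gradient error e is controlled only in second moment, while the decrease is cubic in |h|.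
    Young's inequality with weight L rho, where rho = r / T, bridges the two: e |h| and e^(3/2) are
    bounded through e^2 / (L rho). Since rho is determined by earlier batches, the weight passes
    through the average over the fresh batch, which leaves at most L rho^3. The powers of T hidden
    in r = T rho are paid for by T^4 <= 4 b_g and 16 k T^2 <= b_h. All randomness is a uniform
    choice in a finite product, so conditioning on the past amounts to resampling one coordinate.
    The trace enters (2) because it commutes with averages and the norm does not. The dimension
    factor that it costs is offset by 4^k, gained by doubling a truncation level. The cubic
    subproblem lemmas need symmetric matrices. Symmetry of the Hessians is derived from a Lipschitz
    bound for each component, which third-moment smoothness gives with constant n L. The numerical
    constants have enough slack to absorb rounding of T, S, b_g, b_h in either direction. *)

(** * Euclidean and spectral norms, and traces of even powers *)

Section EuclideanSpace.
Context {R : realType} {d : nat}.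
Implicit Types (u v w : 'rV[R]_d) (A B : 'M[R]_d) (a c : R).

Lemma dotvC u v : dotv u v = dotv v u.
Proof. by apply: eq_bigr => i _; rewrite mulrC. Qed.

Lemma dotvDl u v w : dotv (u + v) w = dotv u w + dotv v w.
Proof. by rewrite -big_split; apply: eq_bigr => i _; rewrite mxE mulrDl. Qed.

Lemma dotvZl a u v : dotv (a *: u) v = a * dotv u v.
Proof. by rewrite mulr_sumr; apply: eq_bigr => i _; rewrite mxE mulrA. Qed.

Lemma dotvDr u v w : dotv u (v + w) = dotv u v + dotv u w.
Proof. by rewrite dotvC dotvDl !(dotvC u). Qed.

Lemma dotvZr a u v : dotv u (a *: v) = a * dotv u v.
Proof. by rewrite dotvC dotvZl dotvC. Qed.

Lemma dotvNl u v : dotv (- u) v = - dotv u v.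
Proof. by rewrite -scaleN1r dotvZl mulN1r. Qed.

Lemma dotvNr u v : dotv u (- v) = - dotv u v.
Proof. by rewrite dotvC dotvNl dotvC. Qed.

Lemma dotvBl u v w : dotv (u - v) w = dotv u w - dotv v w.
Proof. by rewrite dotvDl dotvNl. Qed.

Lemma dotvBr u v w : dotv u (v - w) = dotv u v - dotv u w.
Proof. by rewrite dotvDr dotvNr. Qed.

Lemma dotv0l u : dotv 0 u = 0.
Proof. by rewrite -[0](scale0r 0) dotvZl mul0r. Qed.

Lemma dotv_suml (I : Type) (r : seq I) (P : pred I) (F : I -> 'rV[R]_d) v :
  dotv (\sum_(i <- r | P i) F i) v = \sum_(i <- r | P i) dotv (F i) v.
Proof.
by apply: (big_morph (dotv^~ v)) => [u w|]; [exact: dotvDl | exact: dotv0l].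
Qed.

Lemma dotv_sumr (I : Type) (r : seq I) (P : pred I) (F : I -> 'rV[R]_d) v :
  dotv v (\sum_(i <- r | P i) F i) = \sum_(i <- r | P i) dotv v (F i).
Proof. by rewrite dotvC dotv_suml; apply: eq_bigr => i _; exact: dotvC. Qed.

Lemma dotv_mulmx u v A : dotv (u *m A) v = dotv u (v *m A^T).
Proof.
rewrite /dotv; under eq_bigr do rewrite mxE mulr_suml.
rewrite exchange_big; apply: eq_bigr => i _; rewrite mxE mulr_sumr.
by apply: eq_bigr => j _; rewrite mxE; ring.
Qed.

Lemma dotv_ge0 u : 0 <= dotv u u.
Proof. by apply: sumr_ge0 => i _; rewrite -expr2 sqr_ge0. Qed.

Lemma enorm_ge0 u : 0 <= enorm u.
Proof. exact: sqrtr_ge0. Qed.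

Lemma enorm_sq u : enorm u ^+ 2 = dotv u u.
Proof. by rewrite sqr_sqrtr // dotv_ge0. Qed.

Lemma dotv_eq0 u : (dotv u u == 0) = (u == 0).
Proof.
apply/eqP/eqP => [u0|->]; last exact: dotv0l.
apply/rowP => i; rewrite mxE; apply/eqP; rewrite -sqrf_eq0 expr2.
move/eqP: u0; rewrite psumr_eq0; last by move=> j _; rewrite -expr2 sqr_ge0.
by move/allP/(_ i); rewrite mem_index_enum => /(_ isT).
Qed.

Lemma enorm_eq0 u : (enorm u == 0) = (u == 0).
Proof. by rewrite -dotv_eq0 -enorm_sq sqrf_eq0. Qed.

Lemma enorm0 : enorm (0 : 'rV[R]_d) = 0.
Proof. by apply/eqP; rewrite enorm_eq0. Qed.

Lemma enormZ a u : enorm (a *: u) = `|a| * enorm u.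
Proof.
by rewrite /enorm dotvZl dotvZr mulrA -expr2 sqrtrM ?sqr_ge0 // sqrtr_sqr.
Qed.

Lemma enormN u : enorm (- u) = enorm u.
Proof. by rewrite -scaleN1r enormZ normrN1 mul1r. Qed.

Lemma dotv_le_enorm u v : dotv u v <= enorm u * enorm v.
Proof.
have [->|u0] := eqVneq u 0; first by rewrite dotv0l enorm0 mul0r.
have [->|v0] := eqVneq v 0; first by rewrite dotvC dotv0l enorm0 mulr0.
have pu : 0 < enorm u by rewrite lt_neqAle eq_sym enorm_eq0 u0 enorm_ge0.
have pv : 0 < enorm v by rewrite lt_neqAle eq_sym enorm_eq0 v0 enorm_ge0.
have := dotv_ge0 (enorm v *: u - enorm u *: v).
rewrite !(dotvBl, dotvBr, dotvZl, dotvZr) -!enorm_sq (dotvC v u) => H.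
rewrite -(ler_pM2l (mulr_gt0 pu pv)); nra.
Qed.

Lemma norm_dotv_le u v : `|dotv u v| <= enorm u * enorm v.
Proof.
rewrite ler_norml dotv_le_enorm andbT lerNl -dotvNl -(enormN u).
exact: dotv_le_enorm.
Qed.

Lemma enormD u v : enorm (u + v) <= enorm u + enorm v.
Proof.
rewrite -(@ler_pXn2r _ 2) ?nnegrE ?enorm_ge0 ?addr_ge0 ?enorm_ge0 //.
rewrite enorm_sq dotvDl !dotvDr (dotvC v u) sqrrD !enorm_sq.
by have := dotv_le_enorm u v; lra.
Qed.

Lemma enorm_triangle v u w : enorm (u - w) <= enorm (u - v) + enorm (v - w).
Proof. by have := enormD (u - v) (v - w); rewrite addrA subrK. Qed.

Lemma enorm_sum (I : Type) (r : seq I) (P : pred I) (F : I -> 'rV[R]_d) :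
  enorm (\sum_(i <- r | P i) F i) <= \sum_(i <- r | P i) enorm (F i).
Proof.
elim/big_rec2: _ => [|i y u _ H]; first by rewrite enorm0.
by rewrite (le_trans (enormD _ _)) // lerD2l.
Qed.

Definition frobenius_sq A : R := \sum_i \sum_j A i j ^+ 2.

Lemma frobenius_sq_ge0 A : 0 <= frobenius_sq A.
Proof. by do 2 apply: sumr_ge0 => ? _; exact: sqr_ge0. Qed.

Lemma frobenius_sqE A : frobenius_sq A = \sum_i enorm (delta_mx 0 i *m A) ^+ 2.
Proof.
apply: eq_bigr => i _; rewrite enorm_sq -rowE.
by apply: eq_bigr => j _; rewrite !mxE expr2.
Qed.

Lemma enorm_mulmx_frobenius u A :
  enorm (u *m A) ^+ 2 <= frobenius_sq A * enorm u ^+ 2.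
Proof.
rewrite enorm_sq /frobenius_sq exchange_big /= mulr_suml.
apply: ler_sum => j _; rewrite -expr2.
have -> : (u *m A) 0 j = dotv u (col j A)^T.
  by rewrite mxE; apply: eq_bigr => i _; rewrite !mxE.
rewrite -real_normK ?num_real //.
have -> : \sum_i A i j ^+ 2 = enorm (col j A)^T ^+ 2.
  by rewrite enorm_sq; apply: eq_bigr => i _; rewrite !mxE expr2.
rewrite mulrC -exprMn lerXn2r ?nnegrE ?mulr_ge0 ?enorm_ge0 //.
exact: norm_dotv_le.
Qed.

Let unit_image A := [set enorm (u *m A) | u in [set u | enorm u <= 1]].

(** [sup] is meaningful only on a nonempty bounded set; the Frobenius norm supplies the bound. *)
Lemma has_sup_unit_image A : has_sup (unit_image A).
Proof.
split; first by exists (enorm (0 *m A)), 0 => //=; rewrite enorm0.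
exists (Num.sqrt (frobenius_sq A)) => _ [u /= u1 <-].
rewrite -(@ler_pXn2r _ 2) ?nnegrE ?enorm_ge0 ?sqrtr_ge0 //.
rewrite (sqr_sqrtr (frobenius_sq_ge0 A)).
apply: (le_trans (enorm_mulmx_frobenius u A)).
by rewrite ler_piMr ?frobenius_sq_ge0 // expr_le1 ?enorm_ge0.
Qed.

Lemma spectral_norm_ge0 A : 0 <= spectral_norm A.
Proof.
apply: (sup_upper_bound (has_sup_unit_image A)).
by exists 0; rewrite /= ?enorm0 // mul0mx enorm0.
Qed.

Lemma enorm_mulmx u A : enorm (u *m A) <= spectral_norm A * enorm u.
Proof.
have [->|u0] := eqVneq u 0; first by rewrite mul0mx enorm0 mulr0.
have pu : 0 < enorm u by rewrite lt_neqAle eq_sym enorm_eq0 u0 enorm_ge0.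
rewrite -ler_pdivrMr //; apply: (sup_upper_bound (has_sup_unit_image A)).
exists ((enorm u)^-1 *: u) => /=.
  by rewrite enormZ ger0_norm ?invr_ge0 ?enorm_ge0 // mulVf ?gt_eqF.
by rewrite -scalemxAl enormZ ger0_norm ?invr_ge0 ?enorm_ge0 // mulrC.
Qed.

Lemma spectral_norm_le A c : 0 <= c ->
  (forall u, enorm (u *m A) <= c * enorm u) -> spectral_norm A <= c.
Proof.
move=> c0 H; apply: ge_sup; first by case: (has_sup_unit_image A).
by move=> _ [u /= u1 <-]; rewrite (le_trans (H u)) // ler_piMr.
Qed.

Lemma spectral_norm0 : spectral_norm (0 : 'M[R]_d) = 0.
Proof.
apply/le_anti; rewrite spectral_norm_ge0 andbT; apply: spectral_norm_le => // u.
by rewrite mulmx0 enorm0 mul0r.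
Qed.

Lemma spectral_norm1 : spectral_norm (1%:M : 'M[R]_d) <= 1.
Proof. by apply: spectral_norm_le => // u; rewrite mulmx1 mul1r. Qed.

Lemma spectral_normZ a A : spectral_norm (a *: A) <= `|a| * spectral_norm A.
Proof.
apply: spectral_norm_le => [|u]; first by rewrite mulr_ge0 ?spectral_norm_ge0.
by rewrite -scalemxAr enormZ -mulrA ler_wpM2l // enorm_mulmx.
Qed.

Lemma spectral_normD A B :
  spectral_norm (A + B) <= spectral_norm A + spectral_norm B.
Proof.
apply: spectral_norm_le => [|u]; first by rewrite addr_ge0 ?spectral_norm_ge0.
by rewrite mulmxDr mulrDl (le_trans (enormD _ _)) // lerD ?enorm_mulmx.
Qed.

Lemma spectral_normN A : spectral_norm (- A) <= spectral_norm A.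
Proof.
by have := spectral_normZ (-1) A; rewrite scaleN1r normrN1 mul1r.
Qed.

Lemma spectral_norm_sum (I : Type) (r : seq I) (P : pred I) (F : I -> 'M[R]_d) :
  spectral_norm (\sum_(i <- r | P i) F i)
  <= \sum_(i <- r | P i) spectral_norm (F i).
Proof.
elim/big_rec2: _ => [|i y u _ H]; first by rewrite spectral_norm0.
by rewrite (le_trans (spectral_normD _ _)) // lerD2l.
Qed.

Lemma spectral_normM A B :
  spectral_norm (A *m B) <= spectral_norm A * spectral_norm B.
Proof.
apply: spectral_norm_le => [|u]; first by rewrite mulr_ge0 ?spectral_norm_ge0.
rewrite mulmxA (le_trans (enorm_mulmx _ _)) // (mulrC (spectral_norm A)) -mulrA.
by rewrite ler_wpM2l ?spectral_norm_ge0 // enorm_mulmx.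
Qed.

Lemma quad_form_le u A : `|dotv (u *m A) u| <= spectral_norm A * enorm u ^+ 2.
Proof.
rewrite (le_trans (norm_dotv_le _ _)) // expr2 mulrA.
by rewrite ler_wpM2r ?enorm_ge0 // enorm_mulmx.
Qed.

Lemma lambda_min_ge A c : 0 <= c ->
  (forall u, - (c * enorm u ^+ 2) <= dotv (u *m A) u) -> - c <= lambda_min A.
Proof.
move=> c0 H; rewrite /lambda_min.
have [[a Aa]|E] := pselect (exists a, [set a | eigenvalue A a] a); last first.
  (* Without eigenvalues [lambda_min] takes the default value 0 of [inf], and - c <= 0. *)
  rewrite (_ : [set a | _] = set0) ?inf0 ?oppr_le0 //.
  by apply/seteqP; split => // a Aa; apply: E; exists a.
apply: lb_le_inf; first by exists a.
move=> b /= /eigenvalueP[v vA v0].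
have := H v; rewrite vA dotvZl -enorm_sq -mulNr ler_pM2r //.
by rewrite exprn_gt0 // lt_neqAle eq_sym enorm_eq0 v0 enorm_ge0.
Qed.

Lemma trmx_exp A k : (A ^+ k)^T = A^T ^+ k.
Proof.
elim: k => [|k IH]; first by rewrite !expr0 trmx1.
by rewrite exprSr exprS trmx_mul IH.
Qed.

(* The squares m_j = |u A^j|^2 are log-convex in j by Cauchy-Schwarz. *)
Lemma enorm_mulmx_exp A u k : A^T = A -> enorm u = 1 ->
  enorm (u *m A) ^+ (2 * k) <= enorm (u *m A ^+ k) ^+ 2.
Proof.
move=> symA u1; pose m j := enorm (u *m A ^+ j) ^+ 2.
have m_ge0 j : 0 <= m j by rewrite exprn_ge0 // enorm_ge0.
have m0 : m 0%N = 1 by rewrite /m expr0 mulmx1 u1 expr1n.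
have m1 : m 1%N = enorm (u *m A) ^+ 2 by rewrite /m expr1.
have logconvex j : m j.+1 ^+ 2 <= m j * m j.+2.
  rewrite /m -exprMn lerXn2r ?nnegrE ?exprn_ge0 ?mulr_ge0 ?enorm_ge0 //.
  rewrite enorm_sq {1}exprSr mulmxA dotv_mulmx symA.
  by rewrite (exprSr A j.+1) mulmxA; exact: dotv_le_enorm.
(* By log-convexity the ratios m (j+1) / m j increase from m 1 / m 0 = m 1; the form without
   division survives vanishing m j. *)
have ratio j : m 1%N * m j <= m j.+1.
  elim: j => [|j IH]; first by rewrite m0 mulr1.
  have := logconvex j; have := m_ge0 j.+2; have := m_ge0 j.+1.
  have := m_ge0 j; have := m_ge0 1%N.
  rewrite le_eqVlt => /orP[/eqP<- *|m1_gt0]; first by rewrite mul0r.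
  rewrite le_eqVlt => /orP[/eqP<-|mj_gt0 mj1 mj2 H].
    rewrite mul0r => mj1 mj2 H; have -> : m j.+1 = 0; last by rewrite mulr0.
    by apply/eqP; rewrite -sqrf_eq0 eq_le H sqr_ge0.
  rewrite -(ler_pM2l mj_gt0); apply: le_trans H; nra.
rewrite exprM -m1 -/(m k); elim: k => [|k IH]; first by rewrite expr0 m0.
by rewrite exprS (le_trans _ (ratio k)) // ler_wpM2l.
Qed.

(** A substitute for diagonalization: the largest eigenvalue to the power 2k is at most the trace of
    A^(2k). The supremum need not be known to be attained: each |u A| / |u| is compared with the
    2k-th root [c] of the right-hand side. *)
Lemma spectral_norm_exp A k : A^T = A -> (0 < k)%N ->
  spectral_norm A ^+ (2 * k) <= frobenius_sq (A ^+ k).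
Proof.
move=> symA k0; set F := frobenius_sq _.
have F0 : 0 <= F := frobenius_sq_ge0 _.
pose c := F `^ ((2 * k)%:R^-1).
have c0 : 0 <= c by exact: powR_ge0.
have ck : c ^+ (2 * k) = F.
  rewrite -powR_mulrn // -powRrM mulVf ?powRr1 //.
  by rewrite pnatr_eq0 -lt0n muln_gt0.
rewrite -ck lerXn2r ?nnegrE ?spectral_norm_ge0 //.
apply: spectral_norm_le => // u.
have [->|u0] := eqVneq u 0; first by rewrite mul0mx enorm0 mulr0.
have pu : 0 < enorm u by rewrite lt_neqAle eq_sym enorm_eq0 u0 enorm_ge0.
rewrite -ler_pdivrMr //.
have v1 : enorm ((enorm u)^-1 *: u) = 1.
  by rewrite enormZ ger0_norm ?invr_ge0 ?enorm_ge0 // mulVf ?gt_eqF.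
have -> : enorm (u *m A) / enorm u = enorm (((enorm u)^-1 *: u) *m A).
  by rewrite -scalemxAl enormZ ger0_norm ?invr_ge0 ?enorm_ge0 // mulrC.
rewrite -(@ler_pXn2r _ (2 * k)) ?nnegrE ?enorm_ge0 ?muln_gt0 //.
rewrite (le_trans (enorm_mulmx_exp _ symA v1)) // ck.
by rewrite (le_trans (enorm_mulmx_frobenius _ _)) // v1 expr1n mulr1.
Qed.

(** The right-hand side is the trace of A^(2k), which is linear in that power; averages over random
    A can thus be moved inside. *)
Lemma frobenius_sq_exp A k : A^T = A ->
  frobenius_sq (A ^+ k)
  = \sum_i dotv (delta_mx 0 i *m A ^+ (2 * k)) (delta_mx 0 i).
Proof.
move=> symA; rewrite frobenius_sqE; apply: eq_bigr => i _.
by rewrite enorm_sq mul2n -addnn exprD mulmxA [RHS]dotv_mulmx trmx_exp symA.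
Qed.

Lemma enorm_delta i : enorm (delta_mx 0 i : 'rV[R]_d) = 1.
Proof.
apply/eqP; rewrite -(@eqrXn2 _ 2) ?enorm_ge0 // expr1n enorm_sq.
rewrite /dotv (bigD1 i) //= big1 ?addr0 => [|j ji].
  by rewrite !mxE !eqxx mulr1.
by rewrite !mxE (negPf ji) andbF mulr0.
Qed.

End EuclideanSpace.

(** * Optimality conditions for the cubic subproblem *)

Section CubicModel.
Context {R : realType} {d : nat}.
Implicit Types (u v w h : 'rV[R]_d) (U : 'M[R]_d).

(** First-order optimality at t = 0 without differentiating the cubed norm. The witness t = - a / (2
    (|a| + |b|)) makes the linear term dominate the quadratic one. *)
Lemma linear_coef_eq0 (a b : R) :
  (forall t, `|t| <= 1 -> 0 <= a * t + b * t ^+ 2) -> a = 0.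
Proof.
move=> H; apply/eqP/negPn/negP => a0.
have pa : 0 < `|a| by rewrite normr_gt0.
have pb : 0 <= `|b| by [].
pose s := `|a| + `|b|; have ps : 0 < s by rewrite ltr_pwDl.
pose t := - (a / (2 * s)).
have s0 : s != 0 by rewrite gt_eqF.
have t1 : `|t| <= 1.
  rewrite normrN normrM normfV (gtr0_norm (_ : 0 < 2 * s)) ?mulr_gt0 //.
  by rewrite ler_pdivrMr ?mulr_gt0 // mul1r /s; lra.
have := H t t1.
have -> : a * t + b * t ^+ 2 = a ^+ 2 * (b - 2 * s) / (2 * s) ^+ 2.
  by rewrite /t; field; rewrite s0.
rewrite pmulr_lge0 ?invr_gt0 ?exprn_gt0 ?mulr_gt0 //.
rewrite pmulr_rge0 ?exprn_even_gt0 //.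
by have := ler_norm b; rewrite /s; lra.
Qed.

(* With a = |h| > 0 and y = h + t w, the majorant comes from
   |y| <= (|y|^2 + a^2) / (2 a). *)
Lemma enorm_cube_expand h w : exists b : R, forall t, `|t| <= 1 ->
  enorm (h + t *: w) ^+ 3
  <= enorm h ^+ 3 + 3 * enorm h * dotv h w * t + b * t ^+ 2.
Proof.
have [->|h0] := eqVneq h 0.
  exists (enorm w ^+ 3) => t t1; rewrite enorm0 add0r enormZ exprMn.
  rewrite expr0n /= mulr0 !mul0r !add0r mulrC ler_wpM2l ?exprn_ge0 ?enorm_ge0 //.
  by rewrite exprS real_normK ?num_real // ler_piMl ?sqr_ge0.
have pa : 0 < enorm h by rewrite lt_neqAle eq_sym enorm_eq0 h0 enorm_ge0.
set a := enorm h in pa *; set p := dotv h w; set q := enorm w ^+ 2.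
exists (3 * a * q / 2 + (2 * `|p| + q) ^+ 2 / (2 * a)) => t t1.
set y := enorm _; have y0 : 0 <= y := enorm_ge0 _.
pose z := 2 * t * p + t ^+ 2 * q.
have y2 : y ^+ 2 = a ^+ 2 + z.
  rewrite enorm_sq !(dotvDl, dotvDr, dotvZl, dotvZr) (dotvC w h).
  by rewrite -!enorm_sq -/a -/p -/q /z; ring.
have y3 : y ^+ 3 <= a ^+ 3 + 3 / 2 * a * z + z ^+ 2 / (2 * a).
  have -> : a ^+ 3 + 3 / 2 * a * z + z ^+ 2 / (2 * a)
            = y ^+ 2 * ((y ^+ 2 + a ^+ 2) / (2 * a)).
    by rewrite y2; field; rewrite gt_eqF.
  rewrite exprSr ler_wpM2l ?sqr_ge0 // ler_pdivlMr ?mulr_gt0 //.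
  by have := sqr_ge0 (y - a); lra.
apply: (le_trans y3).
have z2 : z ^+ 2 <= (2 * `|p| + q) ^+ 2 * t ^+ 2.
  rewrite -exprMn -[z ^+ 2]real_normK ?num_real //.
  rewrite -[leRHS]real_normK ?num_real // lerXn2r ?nnegrE //.
  have -> : z = t * (2 * p + t * q) by rewrite /z; ring.
  rewrite !normrM mulrC ler_wpM2r //.
  have q0 : 0 <= q by rewrite exprn_ge0 ?enorm_ge0.
  rewrite (le_trans (ler_normD _ _)) // normrM normr_nat normrM.
  have pq0 : 0 <= 2 * `|p| + q by have := normr_ge0 p; lra.
  rewrite (ger0_norm q0) (ger0_norm pq0).
  by rewrite lerD2l ler_piMl.
have : z ^+ 2 / (2 * a) <= (2 * `|p| + q) ^+ 2 * t ^+ 2 / (2 * a).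
  by apply: ler_wpM2r z2; rewrite invr_ge0; lra.
by rewrite /z; lra.
Qed.

Lemma cubic_modelD M v U h w : U^T = U ->
  cubic_model M v U (h + w) = cubic_model M v U h
  + (dotv v w + dotv (h *m U) w + 1 / 2 * dotv (w *m U) w)
  + M / 6 * (enorm (h + w) ^+ 3 - enorm h ^+ 3).
Proof.
move=> symU; rewrite /cubic_model mulmxDl !(dotvDl, dotvDr).
have -> : dotv (w *m U) h = dotv (h *m U) w by rewrite dotv_mulmx symU dotvC.
by field.
Qed.

Lemma cubic_argmin_first_order M v U h : 0 <= M -> U^T = U ->
  cubic_argmin M v U h -> v + h *m U + (M / 2 * enorm h) *: h = 0.
Proof.
move=> M0 symU minh; set g := _ + _.
suff H w : dotv g w = 0 by apply/eqP; rewrite -dotv_eq0 H.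
have [b Hb] := enorm_cube_expand h w.
apply: (@linear_coef_eq0 _ (1 / 2 * dotv (w *m U) w + M / 6 * b)) => t t1.
have := minh (h + t *: w); rewrite cubic_modelD // -addrA lerDl.
move=> /le_trans; apply.
rewrite -scalemxAl !(dotvDl, dotvZl, dotvZr).
have := Hb t t1; rewrite -lerBlDl => /(ler_wpM2l (divr_ge0 M0 (ler0n R 6))).
by lra.
Qed.

(* For |h + w| = |h| the first-order condition turns the minimality of h into
   the claim for w; any u not orthogonal to h is proportional to such a w,
   namely the one reflecting h across the hyperplane orthogonal to u. *)
Lemma cubic_argmin_second_order M v U h u : 0 <= M -> U^T = U ->
  cubic_argmin M v U h -> 0 <= dotv (u *m U) u + M / 2 * enorm h * enorm u ^+ 2.
Proof.
move=> M0 symU minh; have fo := cubic_argmin_first_order M0 symU minh.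
(* Minimality at h + w after eliminating v by the first-order condition. The cubic remainder has the
   double root |h + w| = |h|, so it vanishes when w preserves the norm. *)
have key w : 0 <= dotv (w *m U) w + M / 2 * enorm h * enorm w ^+ 2
    + M / 3 * (enorm (h + w) - enorm h) ^+ 2 * (enorm (h + w) + enorm h / 2).
  have := minh (h + w); rewrite cubic_modelD // -addrA lerDl.
  have : dotv (v + h *m U + (M / 2 * enorm h) *: h) w = 0.
    by rewrite fo dotv0l.
  rewrite !dotvDl dotvZl.
  have : enorm (h + w) ^+ 2 = enorm h ^+ 2 + 2 * dotv h w + enorm w ^+ 2.
    by rewrite !enorm_sq dotvDl !dotvDr (dotvC w h); ring.
  set s := enorm (h + w); set a := enorm h; move=> E.
  have -> : dotv h w = (s ^+ 2 - a ^+ 2 - enorm w ^+ 2) / 2 by lra.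
  nra.
have [hu0|hu0] := eqVneq (dotv h u) 0; last first.
  have u0 : u != 0 by apply: contra_neq hu0 => ->; rewrite dotvC dotv0l.
  have pu : 0 < enorm u by rewrite lt_neqAle eq_sym enorm_eq0 u0 enorm_ge0.
  pose t := - (2 * dotv h u / enorm u ^+ 2).
  have tE : t * enorm u ^+ 2 = - (2 * dotv h u).
    by rewrite /t mulNr mulfVK // expf_neq0 // gt_eqF.
  have t0 : t != 0 by rewrite oppr_eq0 !mulf_neq0 ?invr_eq0 ?expf_neq0 // gt_eqF.
  have := key (t *: u).
  have -> : enorm (h + t *: u) = enorm h.
    apply/eqP; rewrite -(@eqrXn2 _ 2) ?enorm_ge0 //; apply/eqP.
    rewrite !enorm_sq !(dotvDl, dotvDr, dotvZl, dotvZr) (dotvC u h).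
    rewrite -!enorm_sq; have : t * (t * enorm u ^+ 2) = t * - (2 * dotv h u).
      by rewrite tE.
    by lra.
  rewrite subrr expr0n /= mulr0 mul0r addr0 -scalemxAl dotvZl dotvZr enormZ.
  rewrite exprMn real_normK ?num_real // => H.
  by rewrite -(@pmulr_rge0 _ (t ^+ 2)) ?exprn_even_gt0 //; lra.
(* For u orthogonal to h no nonzero multiple of u preserves the norm, but |h + t u| - |h| lies
   between 0 and t |u|, so the remainder is of order t^3. Dividing by t^2 and taking t small gives
   the claim. *)
set b := _ + _.
have H t : 0 < t -> 0 <= b + M / 3 * t * enorm u ^+ 3.
  move=> t0; have := key (t *: u).
  rewrite -scalemxAl dotvZl dotvZr enormZ (gtr0_norm t0).
  have : enorm (h + t *: u) ^+ 2 = enorm h ^+ 2 + t ^+ 2 * enorm u ^+ 2.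
    rewrite !enorm_sq !(dotvDl, dotvDr, dotvZl, dotvZr) (dotvC u h) hu0.
    by rewrite -!enorm_sq; ring.
  set s := enorm (h + _); set a := enorm h; set q := enorm u => s2.
  have sa : s <= a + t * q.
    by rewrite /s (le_trans (enormD _ _)) // enormZ gtr0_norm.
  have s0 : 0 <= s := enorm_ge0 _.
  have a0 : 0 <= a := enorm_ge0 _.
  have q0 : 0 <= q := enorm_ge0 _.
  have as_ : a <= s.
    rewrite -(@ler_pXn2r _ 2) ?nnegrE // s2 lerDl.
    by rewrite mulr_ge0 ?sqr_ge0.
  have cubeb : (s - a) ^+ 2 * (s + a / 2) <= t ^+ 3 * q ^+ 3.
    apply: (@le_trans _ _ ((s - a) * (t ^+ 2 * q ^+ 2))).
      have -> : t ^+ 2 * q ^+ 2 = (s - a) * (s + a) by rewrite -subr_sqr s2; ring.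
      by rewrite expr2 -!mulrA !ler_wpM2l ?subr_ge0 // lerD2l; lra.
    rewrite (_ : t ^+ 3 * q ^+ 3 = (t * q) * (t ^+ 2 * q ^+ 2)); last by ring.
    by apply: ler_wpM2r; [rewrite mulr_ge0 ?sqr_ge0 | lra].
  have M3 : 0 <= M / 3 by rewrite divr_ge0.
  move=> K; rewrite -(@pmulr_rge0 _ (t ^+ 2)) ?exprn_gt0 //.
  have := ler_wpM2l M3 cubeb; rewrite /b -/a -/q.
  by move: K; rewrite exprMn; lra.
rewrite leNgt; apply/negP => b0.
set c := M / 3 * enorm u ^+ 3.
have c0 : 0 <= c by rewrite mulr_ge0 ?divr_ge0 ?exprn_ge0 ?enorm_ge0.
have := H (- b / (2 * (c + 1))).
have c1 : 0 < c + 1 by lra.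
rewrite divr_gt0 ?mulr_gt0 ?oppr_gt0 // => /(_ isT).
rewrite mulrAC -/c.
have -> : b + c * (- b / (2 * (c + 1))) = b * ((c + 2) / (2 * (c + 1))).
  by field; rewrite gt_eqF.
by rewrite nmulr_rge0 // leNgt divr_gt0 ?mulr_gt0 //; lra.
Qed.

(** The first-order condition tested on h turns the model value into - 1/2 <h U, h> - M/3 |h|^3; the
    second-order condition with u = h gives - 1/2 <h U, h> <= M/4 |h|^3. *)
Lemma cubic_argmin_decrease M v U h : 0 <= M -> U^T = U ->
  cubic_argmin M v U h -> cubic_model M v U h <= - (M / 12 * enorm h ^+ 3).
Proof.
move=> M0 symU minh.
have : dotv (v + h *m U + (M / 2 * enorm h) *: h) h = 0.
  by rewrite (cubic_argmin_first_order M0 symU minh) dotv0l.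
have := cubic_argmin_second_order h M0 symU minh.
rewrite !dotvDl dotvZl -enorm_sq /cubic_model; lra.
Qed.

End CubicModel.

(** * Averages over finite types and moment comparison *)

Section Mean.
Context {R : realType}.

Lemma eq_mean (T : finType) (X Y : T -> R) : X =1 Y -> mean X = mean Y.
Proof. by move=> XY; rewrite /mean (eq_bigr Y). Qed.

Lemma ler_mean (T : finType) (X Y : T -> R) :
  (forall w, X w <= Y w) -> mean X <= mean Y.
Proof. by move=> XY; rewrite ler_wpM2r ?invr_ge0 // ler_sum. Qed.

Lemma mean_ge0 (T : finType) (X : T -> R) : (forall w, 0 <= X w) -> 0 <= mean X.
Proof. by move=> X0; rewrite divr_ge0 // sumr_ge0. Qed.

Lemma meanD (T : finType) (X Y : T -> R) :
  mean (fun w => X w + Y w) = mean X + mean Y.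
Proof. by rewrite /mean big_split mulrDl. Qed.

Lemma meanZ (T : finType) c (X : T -> R) : mean (fun w => c * X w) = c * mean X.
Proof. by rewrite /mean -mulr_sumr mulrA. Qed.

Lemma meanN (T : finType) (X : T -> R) : mean (fun w => - X w) = - mean X.
Proof. by rewrite /mean sumrN mulNr. Qed.

Lemma meanB (T : finType) (X Y : T -> R) :
  mean (fun w => X w - Y w) = mean X - mean Y.
Proof. by rewrite meanD meanN. Qed.

Lemma mean_sum (T I : finType) (X : I -> T -> R) :
  mean (fun w => \sum_i X i w) = \sum_i mean (X i).
Proof. by rewrite /mean exchange_big mulr_suml. Qed.

Lemma mean_cst (T : finType) (c : R) : (0 < #|T|)%N -> mean (fun _ : T => c) = c.
Proof.
move=> T0; rewrite /mean sumr_const -[c *+ _]mulr_natr mulfK //.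
by rewrite pnatr_eq0 -lt0n.
Qed.

Lemma mean_exchange (T U : finType) (X : T -> U -> R) :
  mean (fun t => mean (X t)) = mean (fun u => mean (X ^~ u)).
Proof.
rewrite /mean -!mulr_suml exchange_big /=.
by rewrite -!mulrA (mulrC #|U|%:R^-1).
Qed.

Lemma mean_pair (T U : finType) (X : T * U -> R) :
  mean X = mean (fun t => mean (fun u => X (t, u))).
Proof.
rewrite /mean -mulr_suml pair_bigA /= -mulrA -invfM card_prod natrM mulrC.
by rewrite [in RHS]mulrC (mulrC #|T|%:R); congr (_ * _); apply: eq_bigr => -[].
Qed.

Lemma mean_pair_fst (T U : finType) (X : T -> R) : (0 < #|U|)%N ->
  mean (fun p : T * U => X p.1) = mean X.
Proof. by move=> U0; rewrite mean_pair; apply: eq_mean => t /=; rewrite mean_cst. Qed.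

Lemma mean_pair_snd (T U : finType) (X : U -> R) : (0 < #|T|)%N ->
  mean (fun p : T * U => X p.2) = mean X.
Proof. by move=> T0; rewrite mean_pair /= mean_cst. Qed.

Lemma mean_bij (T U : finType) (h : T -> U) (X : U -> R) : bijective h ->
  mean (fun t => X (h t)) = mean X.
Proof.
move=> bh; rewrite /mean (bij_eq_card bh).
by rewrite [in RHS](reindex h) //; exact: onW_bij.
Qed.

Lemma mean_tuple (T : finType) b (X : b.-tuple T -> R) :
  mean X = mean (fun J : {ffun 'I_b -> T} => X [tuple J j | j < b]).
Proof.
symmetry; apply: mean_bij; exists (fun t => [ffun j => tnth t j]) => [J|t].
  by apply/ffunP => j; rewrite ffunE tnth_mktuple.
by apply: eq_from_tnth => j; rewrite tnth_mktuple ffunE.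
Qed.

(** Jensen by averaging the tangent line of the square at the mean; the cube below is treated in the
    same way. *)
Lemma mean_sqr_le (T : finType) (X : T -> R) : (0 < #|T|)%N ->
  mean X ^+ 2 <= mean (fun w => X w ^+ 2).
Proof.
move=> T0; set m := mean X.
have -> : m ^+ 2 = mean (fun w => 2 * m * X w - m ^+ 2).
  by rewrite meanB meanZ mean_cst // -/m; ring.
by apply: ler_mean => w; have := sqr_ge0 (X w - m); lra.
Qed.

Lemma mean_cube_le (T : finType) (X : T -> R) : (0 < #|T|)%N ->
  (forall w, 0 <= X w) -> mean X ^+ 3 <= mean (fun w => X w ^+ 3).
Proof.
move=> T0 X0; set m := mean X; have m0 : 0 <= m by exact: mean_ge0.
have -> : m ^+ 3 = mean (fun w => 3 * m ^+ 2 * X w - 2 * m ^+ 3).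
  by rewrite meanB meanZ mean_cst // -/m; ring.
apply: ler_mean => w; have Xw := X0 w.
have : 0 <= (X w - m) ^+ 2 * (X w + 2 * m).
  by rewrite mulr_ge0 ?sqr_ge0 //; lra.
by lra.
Qed.

(** Monotonicity of power means, from averaging the pointwise bound 3 c X^2 <= 2 X^3 + c^3 and
    dividing by c; at c = 0 all X vanish. *)
Lemma mean_sqr_le_of_cube (T : finType) (X : T -> R) c : (0 < #|T|)%N ->
  0 <= c -> (forall w, 0 <= X w) -> mean (fun w => X w ^+ 3) <= c ^+ 3 ->
  mean (fun w => X w ^+ 2) <= c ^+ 2.
Proof.
move=> T0; rewrite le_eqVlt => /predU1P[<-|c0] X0 H.
  suff X3 w : X w = 0.
    by rewrite (eq_mean (Y := fun=> 0)) ?mean_cst ?expr0n // => w; rewrite X3 expr0n.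
  have : \sum_w X w ^+ 3 == 0.
    rewrite eq_le sumr_ge0 => [|i _]; last by rewrite exprn_ge0.
    move: H; rewrite expr0n /= /mean ler_pdivrMr ?ltr0n // mul0r => ->.
    by [].
  rewrite psumr_eq0 => [/allP/(_ w)|i _]; last by rewrite exprn_ge0.
  by rewrite mem_index_enum => /(_ isT); rewrite expf_eq0 => /eqP.
have : 3 * c * mean (fun w => X w ^+ 2) <= 2 * c ^+ 3 + c ^+ 3.
  rewrite -meanZ.
  apply: (@le_trans _ _ (mean (fun w => 2 * X w ^+ 3 + c ^+ 3))); last first.
    by rewrite meanD meanZ mean_cst // lerD2r ler_pM2l.
  apply: ler_mean => w; have Xw := X0 w.
  have : 0 <= (X w - c) ^+ 2 * (2 * X w + c).
    by rewrite mulr_ge0 ?sqr_ge0 //; lra.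
  by lra.
move=> K; rewrite -(ler_pM2l c0); lra.
Qed.

Lemma mean_le_of_cube (T : finType) (X : T -> R) c : (0 < #|T|)%N ->
  0 <= c -> (forall w, 0 <= X w) -> mean (fun w => X w ^+ 3) <= c ^+ 3 ->
  mean X <= c.
Proof.
move=> T0 c0 X0 H; rewrite -(@ler_pXn2r _ 3) ?nnegrE ?mean_ge0 //.
by rewrite (le_trans (mean_cube_le T0 X0)).
Qed.

Definition avg {V : lmodType R} {T : finType} (X : T -> V) : V :=
  #|T|%:R^-1 *: \sum_w X w.

Lemma avg_cst (V : lmodType R) (T : finType) (v : V) : (0 < #|T|)%N ->
  avg (fun _ : T => v) = v.
Proof.
move=> T0; rewrite /avg sumr_const -[v *+ _]scaler_nat scalerA mulVf ?scale1r //.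
by rewrite pnatr_eq0 -lt0n.
Qed.

Lemma eq_avg (V : lmodType R) (T : finType) (X Y : T -> V) :
  X =1 Y -> avg X = avg Y.
Proof. by move=> XY; rewrite /avg (eq_bigr Y). Qed.

Lemma avgZ (V : lmodType R) (T : finType) c (X : T -> V) :
  avg (fun w => c *: X w) = c *: avg X.
Proof. by rewrite /avg -scaler_sumr !scalerA mulrC. Qed.

Lemma avg_sum (V : lmodType R) (T I : finType) (X : I -> T -> V) :
  avg (fun w => \sum_i X i w) = \sum_i avg (X i).
Proof. by rewrite /avg exchange_big scaler_sumr. Qed.

Lemma avgB (V : lmodType R) (T : finType) (X Y : T -> V) :
  avg (fun w => X w - Y w) = avg X - avg Y.
Proof. by rewrite /avg sumrB scalerBr. Qed.

Lemma sum_subr_avg (V : lmodType R) (T : finType) (X : T -> V) : (0 < #|T|)%N ->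
  \sum_w (X w - avg X) = 0.
Proof.
move=> T0; rewrite sumrB sumr_const -[avg X *+ _]scaler_nat /avg scalerA.
rewrite divff ?scale1r ?subrr //.
by rewrite pnatr_eq0 -lt0n.
Qed.

Lemma enorm_avg d (T : finType) (X : T -> 'rV[R]_d) :
  enorm (avg X) <= mean (fun w => enorm (X w)).
Proof.
rewrite /avg enormZ ger0_norm ?invr_ge0 // /mean mulrC ler_wpM2r ?invr_ge0 //.
exact: enorm_sum.
Qed.

Lemma spectral_norm_avg d (T : finType) (X : T -> 'M[R]_d) :
  spectral_norm (avg X) <= mean (fun w => spectral_norm (X w)).
Proof.
rewrite /avg (le_trans (spectral_normZ _ _)) // ger0_norm ?invr_ge0 //.
by rewrite /mean mulrC ler_wpM2r ?invr_ge0 // spectral_norm_sum.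
Qed.

Lemma dotv_avg d (T : finType) (X : T -> 'rV[R]_d) v :
  dotv (avg X) v = mean (fun w => dotv (X w) v).
Proof. by rewrite /avg dotvZl dotv_suml /mean mulrC. Qed.

End Mean.

(** * Independence as redrawing one coordinate *)

Section Resampling.
Context {R : realType} {I B : finType}.

Definition update (w : {ffun I -> B}) (i : I) (b : B) : {ffun I -> B} :=
  [ffun j => if j == i then b else w j].

(* (w, b) |-> (update w i b, w i) is a measure-preserving involution. *)
Lemma mean_resample (i : I) (phi : {ffun I -> B} -> B -> R) : (0 < #|B|)%N ->
  (forall w b b', phi (update w i b) b' = phi w b') ->
  mean (fun w : {ffun I -> B} => phi w (w i)) = mean (fun w => mean (phi w)).
Proof.
move=> B0 Hphi.
rewrite -(mean_pair_fst (fun w : {ffun I -> B} => phi w (w i)) B0).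
rewrite -(mean_pair (fun p => phi p.1 p.2)).
pose h (p : {ffun I -> B} * B) := (update p.1 i p.2, p.1 i).
have hK : involutive h.
  move=> [w b]; rewrite /h /= ffunE eqxx; congr pair.
  by apply/ffunP => j; rewrite !ffunE; case: eqP => [->|].
rewrite -[LHS](mean_bij _ (inv_bij hK)); apply: eq_mean => -[w b] /=.
by rewrite ffunE eqxx Hphi.
Qed.

Lemma mean_marginal (i : I) (X : B -> R) : (0 < #|B|)%N ->
  mean (fun w : {ffun I -> B} => X (w i)) = mean X.
Proof.
move=> B0; rewrite (@mean_resample i (fun _ => X)) // mean_cst // card_ffun.
by rewrite expn_gt0 B0.
Qed.

End Resampling.

(** * Variance of a batch mean of vectors *)

Section BatchVariance.
Context {R : realType} {d b : nat} {T : finType}.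

(** The squared norm of the centered sum expands into b^2 inner products. For distinct positions,
    redrawing one of them averages a centered vector to 0, so b diagonal terms remain; centering
    does not increase a second moment. *)
Lemma batch_variance (Z : T -> 'rV[R]_d) : (0 < #|T|)%N -> (0 < b)%N ->
  mean (fun J : {ffun 'I_b -> T} =>
    enorm (b%:R^-1 *: (\sum_j Z (J j)) - avg Z) ^+ 2)
  <= b%:R^-1 * mean (fun i => enorm (Z i) ^+ 2).
Proof.
move=> T0 b0; pose Y i := Z i - avg Z.
have bE : b%:R != 0 :> R by rewrite pnatr_eq0 -lt0n.
have -> : mean (fun J : {ffun 'I_b -> T} =>
      enorm (b%:R^-1 *: (\sum_j Z (J j)) - avg Z) ^+ 2)
    = b%:R^-1 ^+ 2 * mean (fun J : {ffun 'I_b -> T} =>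
        \sum_j \sum_l dotv (Y (J j)) (Y (J l))).
  rewrite -meanZ; apply: eq_mean => J.
  under [in RHS]eq_bigr do rewrite -dotv_sumr.
  rewrite -dotv_suml -enorm_sq -[_^-1]ger0_norm ?invr_ge0 // -exprMn -enormZ.
  rewrite ger0_norm ?invr_ge0 // sumrB scalerBr sumr_const card_ord.
  rewrite -[avg Z *+ _]scaler_nat.
  by rewrite [_ *: (_ *: avg Z)]scalerA mulVf ?scale1r.
rewrite mean_sum; under eq_bigr do rewrite mean_sum.
have cross (j l : 'I_b) : mean (fun J : {ffun 'I_b -> T} => dotv (Y (J j)) (Y (J l)))
    = if l == j then mean (fun i => enorm (Y i) ^+ 2) else 0.
  case: eqP => [->|/eqP lj].
    rewrite (mean_marginal j (fun i => dotv (Y i) (Y i))) //.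
    by apply: eq_mean => i; rewrite enorm_sq.
  rewrite (@mean_resample _ _ _ j (fun J i => dotv (Y i) (Y (J l)))) //; last first.
    by move=> J i i'; rewrite ffunE (negPf lj).
  rewrite (eq_mean (Y := fun=> 0)) => [|J].
    by rewrite mean_cst // card_ffun expn_gt0 T0.
  by rewrite /mean -dotv_suml sum_subr_avg // dotv0l mul0r.
under eq_bigr do under eq_bigr do rewrite cross.
under eq_bigr do rewrite -big_mkcond big_pred1_eq.
rewrite sumr_const card_ord -[mean _ *+ b]mulr_natl mulrA.
rewrite (_ : b%:R^-1 ^+ 2 * b%:R = b%:R^-1); last by field.
rewrite ler_wpM2l ?invr_ge0 //.
have -> : mean (fun i => enorm (Y i) ^+ 2)
        = mean (fun i => enorm (Z i) ^+ 2) - enorm (avg Z) ^+ 2.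
  rewrite (eq_mean (Y := fun i => enorm (Z i) ^+ 2 + enorm (avg Z) ^+ 2
                                  - 2 * dotv (Z i) (avg Z))).
    by rewrite meanB meanD mean_cst // meanZ -dotv_avg -enorm_sq; ring.
  move=> i; rewrite /Y !enorm_sq !(dotvBl, dotvBr) (dotvC (avg Z) (Z i)).
  by ring.
by rewrite gerBl sqr_ge0.
Qed.

End BatchVariance.

(** * Rademacher sums: matrix-to-scalar comparison and the scalar Khintchine inequality *)

Section Rademacher.
Context {R : realType} {d : nat} {I : finType}.
Implicit Types (s : {ffun I -> bool}) (c : I -> nat).

Definition sign s i : R := (-1) ^+ s i.

Definition flip i s : {ffun I -> bool} := [ffun j => (j == i) (+) s j].

Lemma flipK i : involutive (flip i).
Proof. by move=> s; apply/ffunP => j; rewrite !ffunE addbA addbb. Qed.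

Lemma mean_flip i (X : {ffun I -> bool} -> R) :
  mean (fun s => X (flip i s)) = mean X.
Proof. exact: mean_bij (inv_bij (flipK i)). Qed.

Lemma sign_flip i j s : sign (flip i s) j = (if j == i then -1 else 1) * sign s j.
Proof.
rewrite /sign ffunE.
by case: eqP; case: (s j); rewrite /= ?mulN1r ?mul1r ?opprK.
Qed.

Lemma normr_sign s i : `|sign s i| = 1.
Proof. by rewrite /sign normrX normrN1 expr1n. Qed.

(** The sum factorizes over the coordinates into factors 1 + (-1)^(c i), each 0 or 2. *)
Lemma sum_sign_prod_ge0 c : 0 <= \sum_s \prod_i sign s i ^+ c i.
Proof.
rewrite -(bigA_distr_bigA (fun i (e : bool) => ((-1) ^+ e : R) ^+ c i)).
apply: prodr_ge0 => i _; rewrite big_bool /= expr1n expr1 -signr_odd.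
by case: odd; rewrite /= ?expr0 ?expr1; lra.
Qed.

Lemma prod_sign_succ s c j :
  (\prod_i sign s i ^+ c i) * sign s j = \prod_i sign s i ^+ (c i + (i == j))%N.
Proof.
under [RHS]eq_bigr do rewrite exprD.
rewrite big_split /= (bigD1 j (F := fun i => sign s i ^+ (i == j))) //= eqxx expr1.
rewrite [X in _ = _ * (_ * X)]big1 ?mulr1 // => i /negPf ->.
by rewrite expr0.
Qed.

(* Expanding the power into words, every word carries a nonnegative sign
   average, hence norms can be taken word by word. *)
Lemma rademacher_matrix_le (Y : I -> 'M[R]_d) (a : I -> R) p c :
  (forall i, spectral_norm (Y i) <= a i) ->
  spectral_norm (\sum_s (\prod_i sign s i ^+ c i) *: (\sum_j sign s j *: Y j) ^+ p)
  <= \sum_s (\prod_i sign s i ^+ c i) * (\sum_j sign s j * a j) ^+ p.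
Proof.
move=> Ya; elim: p c => [|p IH] c.
  under eq_bigr do rewrite expr0; under [leRHS]eq_bigr do rewrite expr0 mulr1.
  rewrite -scaler_suml (le_trans (spectral_normZ _ _)) //.
  rewrite ger0_norm ?sum_sign_prod_ge0 // ler_piMr ?sum_sign_prod_ge0 //.
  exact: spectral_norm1.
have a0 j : 0 <= a j by exact: le_trans (spectral_norm_ge0 _) (Ya j).
(* Peel off the first letter j of each word; its sign joins the weight, which is why the induction
   is over all exponents c. *)
have -> : \sum_s (\prod_i sign s i ^+ c i) *: (\sum_j sign s j *: Y j) ^+ p.+1
  = \sum_j Y j *m (\sum_s (\prod_i sign s i ^+ (c i + (i == j))%N)
                      *: (\sum_j sign s j *: Y j) ^+ p).
  under [RHS]eq_bigr do rewrite mulmx_sumr.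
  rewrite exchange_big; apply: eq_bigr => s _ /=.
  rewrite exprS -[_ * _]/(_ *m _) mulmx_suml scaler_sumr; apply: eq_bigr => j _.
  by rewrite -scalemxAl scalerA prod_sign_succ scalemxAr.
have -> : \sum_s (\prod_i sign s i ^+ c i) * (\sum_j sign s j * a j) ^+ p.+1
  = \sum_j a j * (\sum_s (\prod_i sign s i ^+ (c i + (i == j))%N)
                      * (\sum_j sign s j * a j) ^+ p).
  under [RHS]eq_bigr do rewrite mulr_sumr.
  rewrite exchange_big; apply: eq_bigr => s _ /=.
  rewrite exprS mulr_suml mulr_sumr; apply: eq_bigr => j _.
  by rewrite -prod_sign_succ; ring.
rewrite (le_trans (spectral_norm_sum _ _ _)) //; apply: ler_sum => j _.
rewrite (le_trans (spectral_normM _ _)) //.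
by rewrite ler_pM ?spectral_norm_ge0.
Qed.

(** In the factorization of the difference each of the p + 1 terms is at most max(|x|, |y|)^p; since
    p is even, this is at most x^p + y^p. *)
Lemma exprB_le_even (x y : R) p : ~~ odd p ->
  `|x ^+ p.+1 - y ^+ p.+1| <= p.+1%:R * `|x - y| * (x ^+ p + y ^+ p).
Proof.
move=> ep; rewrite subrXX normrM -mulrA mulrCA ler_wpM2l //.
rewrite (le_trans (ler_norm_sum _ _ _)) //.
apply: (@le_trans _ _ (\sum_(i < p.+1) (x ^+ p + y ^+ p))); last first.
  by rewrite sumr_const card_ord mulr_natl.
apply: ler_sum => i _ /=.
have ip : (i <= p)%N by rewrite -ltnS.
have xp : x ^+ p = `|x| ^+ p by rewrite -normrX ger0_norm // exprn_even_ge0.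
have yp : y ^+ p = `|y| ^+ p by rewrite -normrX ger0_norm // exprn_even_ge0.
rewrite xp yp normrM !normrX.
have [xy|/ltW yx] := leP `|x| `|y|.
  apply: (@le_trans _ _ (`|y| ^+ p)); last by rewrite lerDr exprn_ge0.
  rewrite -[in leRHS](subnK ip) exprD ler_wpM2r ?exprn_ge0 //.
  by rewrite lerXn2r ?nnegrE.
apply: (@le_trans _ _ (`|x| ^+ p)); last by rewrite lerDl exprn_ge0.
rewrite -[in leRHS](subnK ip) exprD ler_wpM2l ?exprn_ge0 //.
by rewrite lerXn2r ?nnegrE.
Qed.

(** A discrete integration by parts. One factor of the power is expanded over j; averaging with the
    copy in which sign j is flipped replaces x^(p+1) by half a difference, whose increment is only 2
    a j in absolute value. *)
Lemma rademacher_moment_step (a : I -> R) p : ~~ odd p -> (forall i, 0 <= a i) ->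
  mean (fun s => (\sum_j sign s j * a j) ^+ p.+2)
  <= 2 * p.+1%:R * (\sum_j a j ^+ 2) * mean (fun s => (\sum_j sign s j * a j) ^+ p).
Proof.
move=> ep a0; pose x s := \sum_j sign s j * a j.
have xflip j s : x (flip j s) = x s - 2 * (sign s j * a j).
  rewrite /x (bigD1 j) //= [in RHS](bigD1 j) //= sign_flip eqxx.
  rewrite (eq_bigr (fun i => sign s i * a i)) => [|i /negPf ij]; first by ring.
  by rewrite sign_flip ij mul1r.
have -> : mean (fun s => x s ^+ p.+2)
    = \sum_j a j * mean (fun s => sign s j * x s ^+ p.+1).
  under [RHS]eq_bigr do rewrite -meanZ.
  rewrite -mean_sum; apply: eq_mean => s; rewrite exprS {1}/x mulr_suml.
  by apply: eq_bigr => j _; ring.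
rewrite mulr_sumr mulr_suml; apply: ler_sum => j _.
rewrite -/(mean (fun s => x s ^+ p)); set E := mean (fun s => x s ^+ p).
suff : mean (fun s => sign s j * x s ^+ p.+1) <= 2 * p.+1%:R * a j * E.
  by move=> /(ler_wpM2l (a0 j)); rewrite -/(x _) -/E; lra.
have -> : mean (fun s => sign s j * x s ^+ p.+1)
    = 1 / 2 * mean (fun s => sign s j * (x s ^+ p.+1 - x (flip j s) ^+ p.+1)).
  under [X in _ = _ * X]eq_mean do rewrite mulrBr.
  rewrite meanB -[X in _ = _ * (_ - X)](mean_flip j).
  under [X in _ = _ * (_ - X)]eq_mean do rewrite flipK sign_flip eqxx mulN1r mulNr.
  by rewrite meanN; lra.
apply: (@le_trans _ _ (1 / 2 * mean (fun s =>
    2 * p.+1%:R * a j * (x s ^+ p + x (flip j s) ^+ p)))).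
  rewrite ler_pM2l //; apply: ler_mean => s.
  rewrite (le_trans (ler_norm _)) // normrM normr_sign mul1r.
  rewrite (le_trans (exprB_le_even _ _ ep)) // xflip.
  rewrite opprB addrC subrK normrM normrM normr_sign mul1r normr_nat.
  by rewrite (ger0_norm (a0 j)); lra.
by rewrite meanZ meanD (mean_flip j (fun s => x s ^+ p)) -/E; lra.
Qed.

Lemma rademacher_moment (a : I -> R) k : (forall i, 0 <= a i) ->
  mean (fun s => (\sum_j sign s j * a j) ^+ (2 * k))
  <= (4 * k%:R * \sum_j a j ^+ 2) ^+ k.
Proof.
move=> a0; set A := \sum_j _; have A0 : 0 <= A by apply: sumr_ge0 => i _; exact: sqr_ge0.
(* The base 4 k A stays fixed while j grows: the factor 2 (2 j + 1) gained at step j is at most 4 k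
   as long as j < k. *)
suff H j : (j <= k)%N -> mean (fun s => (\sum_j sign s j * a j) ^+ (2 * j))
    <= (4 * k%:R * A) ^+ j by exact: H.
elim: j => [|j IH] jk.
  by rewrite muln0 !expr0 mean_cst // card_ffun expn_gt0 card_bool.
have ej : ~~ odd (2 * j) by rewrite oddM.
rewrite mulnS; apply: le_trans (rademacher_moment_step ej a0) _.
rewrite -/A exprS; apply: ler_pM.
- by rewrite !mulr_ge0.
- by apply: mean_ge0 => s; rewrite exprn_even_ge0.
- have : (2 * j).+1%:R <= 2 * k%:R :> R by rewrite -natrM ler_nat ltn_pmul2l.
  by move=> H; apply: ler_wpM2r => //; lra.
- exact/IH/ltnW.
Qed.

End Rademacher.

(** * Third moment of the deviation of a batch mean of symmetric matrices *)

Section MatrixThirdMoment.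
Context {R : realType} {d : nat}.

(** Truncation at level l: below it x^3 <= l^3, above it x^3 <= l^3 (x / l)^(2k) because 2k >= 3. It
    replaces a fractional power in passing from the moment 2k to the third. *)
Lemma cube_le_pow (x l : R) k : (1 < k)%N -> 0 <= x -> 0 < l ->
  x ^+ 3 <= l ^+ 3 + x ^+ (2 * k) * (l ^+ 3 / l ^+ (2 * k)).
Proof.
move=> k1 x0 l0; have [xl|/ltW lx] := leP x l.
  apply: (@le_trans _ _ (l ^+ 3)); first by rewrite lerXn2r ?nnegrE // ltW.
  by rewrite lerDl !mulr_ge0 ?invr_ge0 ?exprn_ge0 // ltW.
apply: (@le_trans _ _ (x ^+ (2 * k) * (l ^+ 3 / l ^+ (2 * k)))); last first.
  by rewrite lerDr exprn_ge0 // ltW.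
have [m ->] : exists m, (2 * k = 3 + m)%N.
  by case: k k1 => [|[|k]] // _; exists (k + k).+1; rewrite mul2n -addnn !addnS.
rewrite mulrA ler_pdivlMr ?exprn_gt0 // !exprD [leRHS]mulrAC mulrA.
rewrite ler_wpM2l ?mulr_ge0 ?exprn_ge0 ?(ltW l0) //.
by rewrite lerXn2r ?nnegrE // ltW.
Qed.

Lemma sum_sqr_pow3_le (I : finType) (a : I -> R) : (forall i, 0 <= a i) ->
  Num.sqrt (\sum_i a i ^+ 2) ^+ 3 <= Num.sqrt #|I|%:R * \sum_i a i ^+ 3.
Proof.
move=> a0; set A := \sum_i _; set s := Num.sqrt A; set n := Num.sqrt _.
have A0 : 0 <= A by apply: sumr_ge0 => i _; exact: sqr_ge0.
have s3 : 0 <= \sum_i a i ^+ 3 by apply: sumr_ge0 => i _; exact: exprn_ge0.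
have s0 : 0 <= s := sqrtr_ge0 _.
have n0 : 0 <= n := sqrtr_ge0 _.
have n2 : n ^+ 2 = #|I|%:R by rewrite sqr_sqrtr.
have sA : s ^+ 2 = A by rewrite sqr_sqrtr.
move: s0; rewrite le_eqVlt => /predU1P[<-|s_gt0].
  by rewrite expr0n mulr_ge0.
have n_gt0 : 0 < n.
  rewrite lt_neqAle n0 andbT; apply/eqP => n_eq0; move: sA n2; rewrite -n_eq0.
  rewrite expr0n /= => sA /esym/eqP; rewrite pnatr_eq0 => /eqP /card0_eq I0.
  have : A = 0 by rewrite /A big_pred0.
  by move=> A_eq0; move: s_gt0; rewrite /s A_eq0 sqrtr0 ltxx.
(* c is the root mean square of the a i, the point at which 3 c a^2 <= 2 a^3 + c^3 is tight for
   constant a. *)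
pose c := s / n; have c0 : 0 <= c by rewrite divr_ge0 // ltW.
have : \sum_i (3 * c * a i ^+ 2) <= \sum_i (2 * a i ^+ 3 + c ^+ 3).
  apply: ler_sum => i _; have ai := a0 i.
  have : 0 <= (a i - c) ^+ 2 * (2 * a i + c).
    by rewrite mulr_ge0 ?sqr_ge0 //; lra.
  by lra.
rewrite big_split /= sumr_const -!mulr_sumr -/A -sA -[c ^+ 3 *+ _]mulr_natr -n2.
rewrite (_ : 3 * c * s ^+ 2 = 3 * s ^+ 3 / n); last by rewrite /c; field; rewrite gt_eqF.
rewrite (_ : c ^+ 3 * n ^+ 2 = s ^+ 3 / n); last by rewrite /c; field; rewrite gt_eqF.
move=> H; have : s ^+ 3 / n <= \sum_i a i ^+ 3 by lra.
by rewrite ler_pdivrMr // mulrC.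
Qed.

Lemma avg_mxE m p (T : finType) (X : T -> 'M[R]_(m, p)) i j :
  avg X i j = mean (fun w => X w i j).
Proof. by rewrite mxE summxE mulrC. Qed.

Lemma mulmx_avg m p q (T : finType) (u : 'M[R]_(m, p)) (X : T -> 'M[R]_(p, q)) :
  u *m avg X = avg (fun w => u *m X w).
Proof.
apply/matrixP => i j; rewrite avg_mxE mxE; under eq_bigr do rewrite avg_mxE -meanZ.
by rewrite -mean_sum; apply: eq_mean => w; rewrite mxE.
Qed.

(** The trace dominates the power of the norm for every s. Its average is the trace of the averaged
    matrix, hence at most d times the norm of that matrix, which the comparison with scalars
    controls. *)
Lemma rademacher_pow_le (I : finType) (Y : I -> 'M[R]_d) k : (0 < k)%N ->
  (forall i, (Y i)^T = Y i) ->
  mean (fun s : {ffun I -> bool} =>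
    spectral_norm (\sum_i sign s i *: Y i) ^+ (2 * k))
  <= d%:R * (4 * k%:R * \sum_i spectral_norm (Y i) ^+ 2) ^+ k.
Proof.
move=> k0 symY; pose S (s : {ffun I -> bool}) : 'M[R]_d := \sum_i sign s i *: Y i.
have symS s : (S s)^T = S s.
  by rewrite /S linear_sum; apply: eq_bigr => i _; rewrite linearZ /= symY.
pose a i := spectral_norm (Y i).
have avg_le : spectral_norm (avg (fun s => S s ^+ (2 * k)))
    <= (4 * k%:R * \sum_i a i ^+ 2) ^+ k.
  apply: le_trans (rademacher_moment k (fun i => spectral_norm_ge0 (Y i))).
  rewrite /avg (le_trans (spectral_normZ _ _)) // ger0_norm ?invr_ge0 // mulrC.
  rewrite ler_wpM2r ?invr_ge0 //.
  have := @rademacher_matrix_le R d I Y a (2 * k) (fun=> 0%N) (fun i => lexx _).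
  under eq_bigr do rewrite big1 // scale1r.
  by under [leRHS]eq_bigr do rewrite big1 // mul1r.
apply: (@le_trans _ _ (mean (fun s => \sum_i
    dotv (delta_mx 0 i *m S s ^+ (2 * k)) (delta_mx 0 i)))).
  apply: ler_mean => s; rewrite -/(S s) -(frobenius_sq_exp k (symS s)).
  exact: (spectral_norm_exp (symS s) k0).
rewrite mean_sum.
apply: (@le_trans _ _ (\sum_(i < d) (4 * k%:R * \sum_i a i ^+ 2) ^+ k)); last first.
  by rewrite sumr_const card_ord -[_ *+ d]mulr_natl; exact: lexx.
apply: ler_sum => i _; rewrite -dotv_avg -mulmx_avg.
rewrite (le_trans (ler_norm _)) // (le_trans (quad_form_le _ _)) //.
by rewrite enorm_delta expr1n mulr1.
Qed.

Lemma rademacher_third_moment (I : finType) (Y : I -> 'M[R]_d) k : (1 < k)%N ->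
  (d <= 4 ^ k)%N -> (forall i, (Y i)^T = Y i) ->
  mean (fun s : {ffun I -> bool} => spectral_norm (\sum_i sign s i *: Y i) ^+ 3)
  <= 2 * Num.sqrt (16 * k%:R) ^+ 3 * Num.sqrt #|I|%:R
     * \sum_i spectral_norm (Y i) ^+ 3.
Proof.
move=> k1 dk symY; pose a i := spectral_norm (Y i).
have a0 i : 0 <= a i := spectral_norm_ge0 _.
set A := \sum_i a i ^+ 2; have A0 : 0 <= A by apply: sumr_ge0 => i _; exact: sqr_ge0.
apply: (@le_trans _ _ (2 * Num.sqrt (16 * k%:R) ^+ 3 * Num.sqrt A ^+ 3)); last first.
  by rewrite -[leRHS]mulrA ler_wpM2l ?mulr_ge0 ?exprn_ge0 ?sqrtr_ge0 // sum_sqr_pow3_le.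
have := A0; rewrite le_eqVlt => /predU1P[A_eq0|A_gt0].
  rewrite (eq_mean (Y := fun=> 0)) => [|s].
    by rewrite mean_cst ?card_ffun ?expn_gt0 ?card_bool // !mulr_ge0 ?exprn_ge0
       ?sqrtr_ge0.
  suff -> : spectral_norm (\sum_i sign s i *: Y i) = 0 by rewrite expr0n.
  apply/le_anti; rewrite spectral_norm_ge0 andbT.
  rewrite (le_trans (spectral_norm_sum _ _ _)) // big1 // => i _.
  apply/le_anti; rewrite spectral_norm_ge0 andbT (le_trans (spectral_normZ _ _)) //.
  rewrite normr_sign mul1r -/(a i); suff /eqP -> : a i == 0 by [].
  rewrite -sqrf_eq0; move/esym/eqP: A_eq0.
  rewrite psumr_eq0 => [|j _]; last exact: sqr_ge0.
  by move=> /allP/(_ i); rewrite mem_index_enum => /(_ isT).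
have k0 : (0 < k)%N := ltnW k1.
have kR : 0 < k%:R :> R by rewrite ltr0n.
have l2_gt0 : 0 < 16 * k%:R * A by rewrite !mulr_gt0.
rewrite -mulrA -exprMn -sqrtrM ?mulr_ge0 //.
(* l^2 = 16 k A is four times the base 4 k A of the moment bound, so the truncated tail is at most d
   / 4^k <= 1 times l^3. *)
set l := Num.sqrt _; have l0 : 0 < l by rewrite sqrtr_gt0.
have l2 : l ^+ 2 = 16 * k%:R * A by rewrite sqr_sqrtr // ltW.
set S := fun s : {ffun I -> bool} => _.
apply: (@le_trans _ _ (mean (fun s => l ^+ 3 +
    (l ^+ 3 / l ^+ (2 * k)) * spectral_norm (\sum_i sign s i *: Y i) ^+ (2 * k)))).
  apply: ler_mean => s; rewrite [_ * spectral_norm _ ^+ _]mulrC.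
  exact: cube_le_pow (spectral_norm_ge0 _) l0.
rewrite meanD mean_cst ?card_ffun ?expn_gt0 ?card_bool // meanZ.
rewrite mulr_natl mulr2n lerD2l.
have lk : 0 < l ^+ (2 * k) by rewrite exprn_gt0.
rewrite mulrAC ler_pdivrMr // ler_pM2l ?exprn_gt0 //.
apply: (le_trans (rademacher_pow_le k0 symY)); rewrite -/a -/A.
rewrite exprM l2 (_ : 16 * k%:R * A = 4 * (4 * k%:R * A)); last by ring.
rewrite [leRHS]exprMn ler_wpM2r //; first by rewrite exprn_ge0 // !mulr_ge0.
by rewrite -natrX ler_nat.
Qed.

Lemma cube_add_le (x y : R) : 0 <= x -> 0 <= y ->
  (x + y) ^+ 3 <= 4 * (x ^+ 3 + y ^+ 3).
Proof.
move=> x0 y0; have : 0 <= (x - y) ^+ 2 * (x + y).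
  by rewrite mulr_ge0 ?sqr_ge0 ?addr_ge0.
by lra.
Qed.

Lemma avg_marginal m p (I T : finType) i (X : T -> 'M[R]_(m, p)) : (0 < #|T|)%N ->
  avg (fun w : {ffun I -> T} => X (w i)) = avg X.
Proof.
move=> T0; apply/matrixP => j l.
by rewrite !avg_mxE (mean_marginal i (fun t => X t j l)).
Qed.

Context {b : nat} {T : finType}.

(* Exchanging J j and J' j on the coordinates selected by s preserves the law
   of the pair of independent batches (J, J'). *)
Lemma mean_swap (B : T -> 'M[R]_d) (s : {ffun 'I_b -> bool}) :
  mean (fun J : {ffun 'I_b -> T} => mean (fun J' : {ffun 'I_b -> T} =>
    spectral_norm (\sum_j sign s j *: (B (J j) - B (J' j))) ^+ 3))
  = mean (fun J : {ffun 'I_b -> T} => mean (fun J' : {ffun 'I_b -> T} =>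
    spectral_norm (\sum_j (B (J j) - B (J' j))) ^+ 3)).
Proof.
rewrite -(mean_pair (fun p : {ffun 'I_b -> T} * {ffun 'I_b -> T} =>
  spectral_norm (\sum_j sign s j *: (B (p.1 j) - B (p.2 j))) ^+ 3)).
rewrite -(mean_pair (fun p : {ffun 'I_b -> T} * {ffun 'I_b -> T} =>
  spectral_norm (\sum_j (B (p.1 j) - B (p.2 j))) ^+ 3)).
pose h (p : {ffun 'I_b -> T} * {ffun 'I_b -> T}) :=
  ([ffun j => if s j then p.2 j else p.1 j], [ffun j => if s j then p.1 j else p.2 j]).
have hK : involutive h.
  by move=> [J J']; congr pair; apply/ffunP => j; rewrite !ffunE; case: (s j).
rewrite -[RHS](mean_bij _ (inv_bij hK)); apply: eq_mean => -[J J'] /=.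
congr (spectral_norm _ ^+ 3); apply: eq_bigr => j _; rewrite !ffunE /sign.
by case: (s j); rewrite /= ?scale1r ?scaleN1r ?opprB.
Qed.

(** Symmetrization: the deviation is an average over an independent ghost batch J', so Jensen
    reduces it to differences B (J j) - B (J' j), whose signs may be randomized. The Rademacher
    bound then applies for each fixed J and J'. *)
Lemma batch_matrix_third_moment (B : T -> 'M[R]_d) k : (0 < #|T|)%N -> (0 < b)%N ->
  (1 < k)%N -> (d <= 4 ^ k)%N -> (forall i, (B i)^T = B i) ->
  mean (fun J : {ffun 'I_b -> T} =>
    spectral_norm (b%:R^-1 *: (\sum_j B (J j)) - avg B) ^+ 3)
  <= 16 * Num.sqrt (16 * k%:R / b%:R) ^+ 3 * mean (fun i => spectral_norm (B i) ^+ 3).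
Proof.
move=> T0 b0 k1 dk symB; set m3 := mean (fun i => _).
have G0 : (0 < #|{: {ffun 'I_b -> T}}|)%N by rewrite card_ffun expn_gt0 T0.
have H0 : (0 < #|{: {ffun 'I_b -> bool}}|)%N by rewrite card_ffun expn_gt0 card_bool.
have bR : 0 < b%:R :> R by rewrite ltr0n.
have bE : b%:R != 0 :> R by rewrite gt_eqF.
pose D (J J' : {ffun 'I_b -> T}) := \sum_j (B (J j) - B (J' j)).
apply: (@le_trans _ _ (mean (fun J => mean (fun J' =>
    b%:R^-1 ^+ 3 * spectral_norm (D J J') ^+ 3)))).
  apply: ler_mean => J.
  have -> : b%:R^-1 *: (\sum_j B (J j)) - avg B = avg (fun J' => b%:R^-1 *: D J J').
    rewrite [RHS](_ : _ = avg (fun J' : {ffun 'I_b -> T} =>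
      b%:R^-1 *: (\sum_j B (J j)) - b%:R^-1 *: (\sum_j B (J' j)))); last first.
      by apply: eq_avg => J'; rewrite /D sumrB scalerBr.
    rewrite avgB avg_cst //; congr (_ - _).
    rewrite avgZ avg_sum (eq_bigr (fun=> avg B)) => [|j _].
      by rewrite sumr_const card_ord -[avg B *+ b]scaler_nat scalerA mulVf ?scale1r.
    exact: avg_marginal.
  apply: (@le_trans _ _ (mean (fun J' => spectral_norm (b%:R^-1 *: D J J')) ^+ 3)).
    rewrite lerXn2r ?nnegrE ?spectral_norm_ge0 ?spectral_norm_avg //.
    by apply: mean_ge0 => J'; exact: spectral_norm_ge0.
  rewrite (le_trans (mean_cube_le G0 _)) // => [J'|]; first exact: spectral_norm_ge0.
  apply: ler_mean => J'; rewrite -exprMn lerXn2r ?nnegrE ?spectral_norm_ge0 //.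
    by rewrite mulr_ge0 ?invr_ge0 ?spectral_norm_ge0.
  by rewrite (le_trans (spectral_normZ _ _)) // ger0_norm ?invr_ge0.
under eq_mean do rewrite meanZ.
(* A constant is written as an average over all sign patterns s; [mean_swap] then inserts the signs
   for each s separately. *)
rewrite meanZ -[X in _ * X](mean_cst _ H0).
under [X in _ * X]eq_mean => s do rewrite -(mean_swap B s).
rewrite mean_exchange; under [X in _ * X]eq_mean => J do rewrite mean_exchange.
pose K := 2 * Num.sqrt (16 * k%:R) ^+ 3 * Num.sqrt b%:R : R.
have K0 : 0 <= K by rewrite !mulr_ge0 ?exprn_ge0 ?sqrtr_ge0.
apply: (@le_trans _ _ (b%:R^-1 ^+ 3 * (K * (b%:R * (8 * m3))))); last first.
  rewrite (sqrtrM _ (_ : 0 <= 16 * k%:R)) ?mulr_ge0 // sqrtrV // exprMn exprVn /K.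
  set q := Num.sqrt b%:R; set p := Num.sqrt (16 * _).
  have q0 : 0 < q by rewrite sqrtr_gt0.
  have <- : q ^+ 2 = b%:R by rewrite sqr_sqrtr // ltW.
  rewrite le_eqVlt; apply/orP; left; apply/eqP; field; rewrite gt_eqF //.
rewrite ler_wpM2l ?exprn_ge0 ?invr_ge0 //.
apply: (@le_trans _ _ (mean (fun J : {ffun 'I_b -> T} =>
  mean (fun J' : {ffun 'I_b -> T} =>
    K * \sum_j (4 * (spectral_norm (B (J j)) ^+ 3 + spectral_norm (B (J' j)) ^+ 3)))))).
  apply: ler_mean => J; apply: ler_mean => J'.
  have symD j : (B (J j) - B (J' j))^T = B (J j) - B (J' j).
    by rewrite linearB /= !symB.
  apply: le_trans (rademacher_third_moment k1 dk symD) _.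
  rewrite card_ord -/K ler_wpM2l // ler_sum // => j _.
  rewrite (le_trans _ (cube_add_le (spectral_norm_ge0 _) (spectral_norm_ge0 _))) //.
  rewrite lerXn2r ?nnegrE ?addr_ge0 ?spectral_norm_ge0 //.
  by rewrite (le_trans (spectral_normD _ _)) // lerD2l spectral_normN.
under eq_mean => J do rewrite meanZ mean_sum.
rewrite meanZ ler_wpM2l // mean_sum.
rewrite (eq_bigr (fun=> 8 * m3)) => [|j _].
  by rewrite sumr_const card_ord -[_ *+ b]mulr_natl lexx.
rewrite (eq_mean (Y := fun J : {ffun 'I_b -> T} =>
  4 * (spectral_norm (B (J j)) ^+ 3 + m3))) => [|J].
  rewrite meanZ meanD mean_cst //.
  rewrite (mean_marginal j (fun i => spectral_norm (B i) ^+ 3)) //.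
  by rewrite -/m3; ring.
by rewrite meanZ meanD mean_cst // (mean_marginal j (fun i => spectral_norm (B i) ^+ 3)).
Qed.

End MatrixThirdMoment.

(** * Derivatives along lines, and symmetry of a Lipschitz Hessian *)

Section LineDerivatives.
Context {R : realType} {d : nat}.
Implicit Types (x y u v w : 'rV[R]_d).

Definition twice_differentiable (g : 'rV[R]_d -> R) :=
  (forall x, differentiable g x) /\ (forall x, differentiable (grad g) x).

Lemma is_derive_line (W : normedModType R) (g : 'rV[R]_d -> W) x u (t : R) :
  differentiable g (x + t *: u) ->
  is_derive t 1 (fun t => g (x + t *: u)) ('D_u g (x + t *: u)).
Proof.
move=> dg.
have E : (fun h : R => h^-1 *: (((fun t => g (x + t *: u)) \o shift t) (h *: 1)
      - g (x + t *: u)))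
    = (fun h : R => h^-1 *: ((g \o shift (x + t *: u)) (h *: u) - g (x + t *: u))).
  apply/funext => h /=; congr (_ *: (g _ - _)).
  by rewrite [h *: 1]mulr1 scalerDl addrCA.
have := diff_derivable (v := u) dg.
by move=> dgu; apply: DeriveDef; rewrite /derivable /derive E.
Qed.

Lemma derive_grad (g : 'rV[R]_d -> R) y u :
  differentiable g y -> 'D_u g y = dotv (grad g y) u.
Proof.
move=> dg; rewrite deriveE // {1}[u]row_sum_delta linear_sum; apply: eq_bigr => j _.
by rewrite linearZ /= -deriveE // mxE mulrC.
Qed.

Lemma derive_hess (g : 'rV[R]_d -> R) y u : twice_differentiable g ->
  'D_u (grad g) y = u *m hess g y.
Proof. by move=> [_ dg]; rewrite deriveEjacobian. Qed.

Lemma is_derive_line_grad g x u (t : R) : twice_differentiable g ->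
  is_derive t 1 (fun t => g (x + t *: u)) (dotv (grad g (x + t *: u)) u).
Proof. by move=> [dg _]; rewrite -derive_grad //; exact: is_derive_line. Qed.

Lemma is_derive_line_hess g x u w (t : R) : twice_differentiable g ->
  is_derive t 1 (fun t => dotv (grad g (x + t *: u)) w)
    (dotv (u *m hess g (x + t *: u)) w).
Proof.
move=> dg; rewrite -derive_hess //.
have [dG DE] := is_derive_line (dg.2 (x + t *: u)).
move: (derive_mx dG); rewrite DE => ->.
have H : is_derive t (1 : R)
    (\sum_(i < d) (w 0 i *: (fun t : R => grad g (x + t *: u) 0 i : R)))
    (\sum_(i < d) w 0 i *: 'D_1 (fun t : R => grad g (x + t *: u) 0 i : R) t).
  apply: is_derive_sum => i; apply: is_deriveZ; apply: derivableP.
  by move/derivable_mxP : dG; apply.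
rewrite [F in is_derive _ _ F _](_ : _ =
  \sum_(i < d) (w 0 i *: (fun t : R => grad g (x + t *: u) 0 i : R))).
  apply: (is_derive_eq H).
  by apply: eq_bigr => i _; rewrite mxE mulrC.
by apply/funext => s; rewrite fct_sumE; apply: eq_bigr => i _; rewrite mulrC.
Qed.

Lemma is_derive_quadratic (a b t : R) :
  is_derive t (1 : R) (fun t => a * t + b / 2 * t ^+ 2) (a + b * t).
Proof.
have -> : (fun t => a * t + b / 2 * t ^+ 2)
    = (a *: (id : R -> R)) + ((b / 2) *: (id : R -> R) ^+ 2).
  by apply/funext => s; rewrite !fctE.
apply: (is_derive_eq (is_deriveD (is_deriveZ a (is_derive_id t 1))
  (is_deriveZ (b / 2) (is_deriveX 2 (is_derive_id t 1))))).
by rewrite expr1 /GRing.scale /=; field.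
Qed.

(** Does the work of integrating the bound on the derivative: the mean value theorem for phi t - c
    t^(k+1). *)
Lemma mvt_pow_le (phi dphi : R -> R) (c : R) k :
  (forall t : R, is_derive t (1 : R) phi (dphi t)) ->
  (forall t, 0 < t < 1 -> dphi t <= c * (k.+1%:R * t ^+ k)) ->
  phi 1 - phi 0 <= c.
Proof.
move=> dp H; pose psi t := phi t - c * t ^+ k.+1.
have dpsi (t : R) : is_derive t (1 : R) psi (dphi t - c * (k.+1%:R * t ^+ k)).
  have -> : psi = phi - (c *: (id : R -> R) ^+ k.+1).
    by apply/funext => s; rewrite /psi !fctE.
  by apply: is_deriveB; apply: is_derive_eq; rewrite [X in _ *: X]mulr1.
have cpsi : {within `[0, 1], continuous psi}.
  by apply: derivable_within_continuous => t _; case: (dpsi t).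
have [t t01] := MVT (@ltr01 R) (fun t _ => dpsi t) cpsi.
rewrite subr0 mulr1 /psi expr1n expr0n /= mulr1 mulr0 subr0 => E.
have : dphi t - c * (k.+1%:R * t ^+ k) <= 0.
  by rewrite subr_le0 H //; move: t01; rewrite in_itv.
by rewrite -E; lra.
Qed.

(** The mean value theorem fails for vector-valued maps, hence the fixed test vector w; the point t
    depends on it. *)
Lemma grad_mvt g x u w : twice_differentiable g ->
  exists2 t, 0 < t < 1 &
    dotv (grad g (x + u) - grad g x) w = dotv (u *m hess g (x + t *: u)) w.
Proof.
move=> dg; have [t t01] := MVT (@ltr01 R)
  (fun t _ => is_derive_line_hess x u w t dg)
  (derivable_within_continuous (fun t _ =>
    let: DeriveDef h _ := is_derive_line_hess x u w t dg in h)).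
rewrite subr0 mulr1 scale1r scale0r addr0 -dotvBl => E.
by exists t; [move: t01; rewrite in_itv | exact: E].
Qed.

(** The factor 1/2 of a Taylor remainder is given up: for the symmetry of the Hessian only the
    quadratic order in u matters. *)
Lemma grad_remainder_le g x u w K : 0 <= K -> twice_differentiable g ->
  (forall y z, spectral_norm (hess g y - hess g z) <= K * enorm (y - z)) ->
  `|dotv (grad g (x + u) - grad g x - u *m hess g x) w|
  <= K * enorm u ^+ 2 * enorm w.
Proof.
move=> K0 dg lip; have [t /andP[t0 t1] E] := grad_mvt x u w dg.
rewrite dotvBl E -dotvBl -mulmxBr (le_trans (norm_dotv_le _ _)) //.
rewrite ler_wpM2r ?enorm_ge0 // (le_trans (enorm_mulmx _ _)) //.
rewrite expr2 mulrA ler_wpM2r ?enorm_ge0 // (le_trans (lip _ _)) // ler_wpM2l //.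
rewrite addrC addKr enormZ gtr0_norm // ler_piMl ?enorm_ge0 //.
exact: ltW.
Qed.

(* Both mixed second differences of g at scale t agree with t^2 times the
   Hessian form up to O(t^3). *)
Lemma hess_sym g x K : 0 <= K -> twice_differentiable g ->
  (forall y z, spectral_norm (hess g y - hess g z) <= K * enorm (y - z)) ->
  (hess g x)^T = hess g x.
Proof.
move=> K0 dg lip; set H := hess g x.
have key u v t : 0 < t -> `|g (x + t *: u + t *: v) - g (x + t *: u)
      - g (x + t *: v) + g x - t ^+ 2 * dotv (v *m H) u|
    <= t ^+ 3 * (K * ((enorm u + enorm v) ^+ 2 + enorm u ^+ 2) * enorm u).
  (* The mixed second difference is the increment of phi over [0, 1], where phi compares the two
     parallel segments in direction t u that start at x + t v and at x. *)
  move=> t0; pose phi s := g (x + t *: v + s *: (t *: u)) - g (x + s *: (t *: u)).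
  pose dphi s := dotv (grad g (x + t *: v + s *: (t *: u))) (t *: u)
                 - dotv (grad g (x + s *: (t *: u))) (t *: u).
  have dP (s : R) : is_derive s 1 phi (dphi s).
    by apply: is_deriveB; exact: is_derive_line_grad.
  have [s] := MVT (@ltr01 R) (fun t _ => dP t)
    (derivable_within_continuous (fun t _ => let: DeriveDef h _ := dP t in h)).
  rewrite in_itv /= => /andP[s0 s1]; rewrite subr0 mulr1 /phi /dphi !scale0r !addr0.
  rewrite !scale1r => E.
  have -> : g (x + t *: u + t *: v) - g (x + t *: u) - g (x + t *: v) + g x
      = g (x + t *: v + t *: u) - g (x + t *: u) - (g (x + t *: v) - g x).
    by rewrite (addrAC x (t *: u)); ring.
  rewrite E; set y2 := s *: (t *: u); pose y1 := t *: v + y2.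
  rewrite -(addrA x) -/y1 -dotvBl dotvZr.
  have y12 : y1 - y2 = t *: v by rewrite /y1 addrK.
  have -> : t * dotv (grad g (x + y1) - grad g (x + y2)) u - t ^+ 2 * dotv (v *m H) u
    = t * (dotv (grad g (x + y1) - grad g x - y1 *m H) u
           - dotv (grad g (x + y2) - grad g x - y2 *m H) u).
    have : t * dotv (v *m H) u = dotv (y1 *m H) u - dotv (y2 *m H) u.
      by rewrite -dotvBl -mulmxBl y12 -scalemxAl dotvZl.
    by rewrite !dotvBl; set a := dotv (v *m H) u => Ha; rewrite expr2 -mulrA Ha; ring.
  have n2 : enorm y2 <= t * enorm u.
    rewrite /y2 !enormZ !gtr0_norm // ler_piMl ?mulr_ge0 ?enorm_ge0 // ltW //.
  have n1 : enorm y1 <= t * (enorm u + enorm v).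
    rewrite (le_trans (enormD _ _)) // enormZ gtr0_norm //.
    by rewrite mulrDr addrC lerD2r.
  rewrite normrM gtr0_norm // exprS -mulrA ler_pM2l //.
  rewrite (le_trans (ler_normB _ _)) //.
  have R1 := grad_remainder_le x y1 u K0 dg lip.
  have R2 := grad_remainder_le x y2 u K0 dg lip.
  rewrite (le_trans (lerD R1 R2)) //.
  have sq (y : 'rV[R]_d) b : 0 <= b -> enorm y <= t * b ->
      enorm y ^+ 2 <= t ^+ 2 * b ^+ 2.
    by move=> b0 yb; rewrite -exprMn lerXn2r ?nnegrE ?enorm_ge0 // mulr_ge0 // ltW.
  have := lerD (sq _ _ (addr_ge0 (enorm_ge0 u) (enorm_ge0 v)) n1)
               (sq _ _ (enorm_ge0 u) n2).
  by move=> /(ler_wpM2l (mulr_ge0 K0 (enorm_ge0 u))); lra.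
have bilin_sym u v : dotv (v *m H) u = dotv (u *m H) v.
  apply/eqP; rewrite -subr_eq0; apply/negPn/negP; rewrite -normr_gt0.
  set D := _ - _ => D0.
  pose C u v := K * ((enorm u + enorm v) ^+ 2 + enorm u ^+ 2) * enorm u.
  have C0 a b : 0 <= C a b by rewrite !mulr_ge0 ?addr_ge0 ?sqr_ge0 ?enorm_ge0.
  have bound t : 0 < t -> `|D| <= t * (C u v + C v u).
    move=> t0; rewrite -(ler_pM2l (exprn_gt0 2 t0)) -{1}(gtr0_norm (exprn_gt0 2 t0)).
    rewrite -normrM; have k1 := key u v t t0; have k2 := key v u t t0.
    rewrite -/(C u v) in k1; rewrite -/(C v u) in k2.
    suff : `|t ^+ 2 * D| <= t ^+ 3 * C v u + t ^+ 3 * C u v by lra.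
    apply: le_trans (lerD k2 k1); apply: le_trans (ler_normB _ _).
    rewrite le_eqVlt; apply/orP; left; apply/eqP.
    by congr `| _ |; rewrite /D (addrAC x (t *: v)); ring.
  have S0 : 0 < C u v + C v u + 1 by rewrite ltr_wpDl ?addr_ge0.
  have := bound (`|D| / (2 * (C u v + C v u + 1))).
  rewrite divr_gt0 ?mulr_gt0 // => /(_ isT).
  rewrite mulrAC ler_pdivlMr ?mulr_gt0 // ler_pM2l //.
  by have := C0 u v; have := C0 v u; lra.
have entry i j : H i j = dotv (delta_mx 0 i *m H) (delta_mx 0 j).
  rewrite -rowE /dotv (bigD1 j) //= big1 => [|l lj].
    by rewrite !mxE !eqxx mulr1 addr0.
  by rewrite !mxE (negPf lj) andbF mulr0.
by apply/matrixP => i j; rewrite mxE !entry bilin_sym.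
Qed.

End LineDerivatives.

(** * Consequences of third-moment smoothness for the components and the objective *)

Section FiniteSumSmoothness.
Context {R : realType} {d n : nat} (f : 'I_n -> 'rV[R]_d -> R) (L : R).
Hypotheses (n_gt0 : (0 < n)%N) (L_ge0 : 0 <= L) (smooth : third_moment_smooth f L).
Implicit Types (x y u v w h : 'rV[R]_d).

Local Notation F := (objective f).

Let card_gt0 : (0 < #|'I_n|)%N. Proof. by rewrite card_ord. Qed.

Let df i : twice_differentiable (f i).
Proof. by have [] := smooth.1 i. Qed.

Let objectiveE : F = #|'I_n|%:R^-1 *: \sum_(i < n) f i.
Proof. by apply/funext => x; rewrite /objective /mean fctE fct_sumE mulrC. Qed.

Lemma differentiable_objective x : differentiable F x.
Proof.
rewrite objectiveE; apply: differentiableZ; apply: differentiable_sum => i.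
exact: (df i).1.
Qed.

Lemma grad_objective : grad F = fun x => avg (fun i => grad (f i) x).
Proof.
apply/funext => x; apply/rowP => j; rewrite avg_mxE mxE objectiveE.
have dj i : derivable (f i) x (delta_mx 0 j).
  by apply: diff_derivable; exact: (df i).1.
rewrite deriveZ ?derive_sum //; last exact: derivable_sum.
by rewrite /mean mulrC; congr (_ * _); apply: eq_bigr => i _; rewrite mxE.
Qed.

Let grad_objectiveE : grad F = #|'I_n|%:R^-1 *: \sum_(i < n) grad (f i).
Proof. by rewrite grad_objective; apply/funext => x; rewrite fctE fct_sumE. Qed.

Lemma twice_differentiable_objective : twice_differentiable F.
Proof.
split=> x; first exact: differentiable_objective.
rewrite grad_objectiveE; apply: differentiableZ; apply: differentiable_sum => i.
exact: (df i).2.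
Qed.

Lemma hess_objective x : hess F x = avg (fun i => hess (f i) x).
Proof.
apply/row_matrixP => j; rewrite rowE -(derive_hess _ _ twice_differentiable_objective).
rewrite rowE mulmx_avg grad_objectiveE.
have dj i : derivable (grad (f i)) x (delta_mx 0 j).
  by apply: diff_derivable; exact: (df i).2.
rewrite deriveZ ?derive_sum //; last exact: derivable_sum.
by apply: eq_avg => i; rewrite derive_hess.
Qed.

Lemma mean_hess_cube x y :
  mean (fun i => spectral_norm (hess (f i) x - hess (f i) y) ^+ 3)
  <= (L * enorm (x - y)) ^+ 3.
Proof.
set m := mean _; have m0 : 0 <= m.
  by apply: mean_ge0 => i; rewrite exprn_ge0 ?spectral_norm_ge0.
have -> : m = (m `^ (1 / 3)) ^+ 3.
  rewrite -powR_mulrn ?powR_ge0 // -powRrM (_ : 1 / 3 * 3%:R = 1) ?powRr1 //.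
  by field.
by rewrite lerXn2r ?nnegrE ?powR_ge0 ?mulr_ge0 ?enorm_ge0 //; exact: smooth.2.
Qed.

Lemma mean_hess_sqr x y :
  mean (fun i => spectral_norm (hess (f i) x - hess (f i) y) ^+ 2)
  <= (L * enorm (x - y)) ^+ 2.
Proof.
apply: mean_sqr_le_of_cube (mean_hess_cube x y) => //.
  by rewrite mulr_ge0 ?enorm_ge0.
by move=> i; exact: spectral_norm_ge0.
Qed.

Lemma hess_objective_lipschitz x y :
  spectral_norm (hess F x - hess F y) <= L * enorm (x - y).
Proof.
rewrite !hess_objective -avgB (le_trans (spectral_norm_avg _)) //.
apply: mean_le_of_cube (mean_hess_cube x y) => //.
  by rewrite mulr_ge0 ?enorm_ge0.
by move=> i; exact: spectral_norm_ge0.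
Qed.

(** One nonnegative term of a mean is at most n times the mean, so every component has a Lipschitz
    Hessian, with constant n^(1/3) L <= n L. The size is irrelevant: only symmetry is extracted. *)
Lemma hess_component_sym i x : (hess (f i) x)^T = hess (f i) x.
Proof.
apply: (@hess_sym _ _ (f i) x (n%:R * L)) => // [|y z]; first exact: mulr_ge0.
rewrite -mulrA; set s := spectral_norm _; set c := L * _.
have c0 : 0 <= c by rewrite mulr_ge0 ?enorm_ge0.
have s0 : 0 <= s := spectral_norm_ge0 _.
rewrite -(@ler_pXn2r _ 3) ?nnegrE ?mulr_ge0 ?enorm_ge0 //.
apply: (@le_trans _ _ (n%:R * c ^+ 3)); last first.
  rewrite [leRHS]exprMn ler_wpM2r ?exprn_ge0 // -natrX ler_nat.
  by rewrite -{1}(expn1 n) leq_pexp2l.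
have := mean_hess_cube y z; rewrite -/c /mean ler_pdivrMr ?ltr0n // card_ord mulrC.
apply: le_trans; rewrite (bigD1 i) //= lerDl sumr_ge0 // => j _.
by rewrite exprn_ge0 ?spectral_norm_ge0.
Qed.

Lemma hess_objective_sym x : (hess F x)^T = hess F x.
Proof.
rewrite hess_objective; apply/matrixP => j l; rewrite mxE !avg_mxE.
by apply: eq_mean => i; rewrite -[in LHS](hess_component_sym i x) mxE.
Qed.

Definition grad_remainder y u (i : 'I_n) : 'rV[R]_d :=
  grad (f i) (y + u) - grad (f i) y - u *m hess (f i) y.

(* Testing the remainders against themselves reduces the claim to the mean
   value theorem for one scalar function. *)
Lemma mean_grad_remainder_sqr y u :
  mean (fun i => enorm (grad_remainder y u i) ^+ 2)
  <= (L / 2 * enorm u ^+ 2) ^+ 2.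
Proof.
pose Z := grad_remainder y u; set m := mean _.
have m0 : 0 <= m by apply: mean_ge0 => i; rewrite exprn_ge0 ?enorm_ge0.
pose W := Num.sqrt m; have W0 : 0 <= W := sqrtr_ge0 _.
have mW : m = W ^+ 2 by rewrite sqr_sqrtr.
have c0 : 0 <= L / 2 * enorm u ^+ 2.
  by rewrite mulr_ge0 ?divr_ge0 ?exprn_ge0 ?enorm_ge0.
rewrite mW lerXn2r ?nnegrE //; move: W0; rewrite le_eqVlt => /predU1P[<-//|W_gt0].
pose phi t := mean (fun i => dotv (grad (f i) (y + t *: u)) (Z i)
                             - t * dotv (u *m hess (f i) y) (Z i)).
pose dphi t := mean (fun i => dotv (u *m hess (f i) (y + t *: u)) (Z i)
                              - dotv (u *m hess (f i) y) (Z i)).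
have dP (t : R) : is_derive t (1 : R) phi (dphi t).
  have -> : phi = #|'I_n|%:R^-1 *: \sum_(i < n) (fun t : R =>
      dotv (grad (f i) (y + t *: u)) (Z i) - t * dotv (u *m hess (f i) y) (Z i)).
    by apply/funext => s; rewrite /phi /mean fctE fct_sumE mulrC.
  rewrite /dphi /mean mulrC; apply: is_deriveZ; apply: is_derive_sum => i.
  apply: is_deriveB; first exact: is_derive_line_hess.
  have -> : (fun t : R => t * dotv (u *m hess (f i) y) (Z i))
      = dotv (u *m hess (f i) y) (Z i) *: (id : R -> R).
    by apply/funext => s; rewrite fctE mulrC.
  by apply: is_derive_eq; rewrite [_ *: _]mulr1.
(* Testing against Z itself makes the increment of phi equal to W^2; one factor W then cancels. *)
suff : phi 1 - phi 0 <= L / 2 * enorm u ^+ 2 * W.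
  have -> : phi 1 - phi 0 = W * W.
    rewrite /phi -meanB -expr2 -mW; apply: eq_mean => i.
    rewrite scale1r scale0r addr0 mul1r mul0r subr0 addrAC -!dotvBl.
    by rewrite -enorm_sq.
  by rewrite ler_pM2r.
apply: (mvt_pow_le (k := 1) dP) => t /andP[t0 t1]; rewrite expr1.
have [u0|u0] := eqVneq (enorm u) 0.
  have {}u0 : u = 0 by apply/eqP; rewrite -enorm_eq0 u0.
  rewrite /dphi (eq_mean (Y := fun=> 0)) => [|i]; last first.
    by rewrite -dotvBl -mulmxBr u0 mul0mx dotv0l.
  rewrite mean_cst //; apply: mulr_ge0; first by rewrite mulr_ge0 // ltW.
  by rewrite mulr_ge0 // ltW.
have pu : 0 < enorm u by rewrite lt_neqAle eq_sym u0 enorm_ge0.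
have [L0|L_neq0] := eqVneq L 0.
  have H i : spectral_norm (hess (f i) (y + t *: u) - hess (f i) y) = 0.
    have := mean_hess_sqr (y + t *: u) y; rewrite L0 mul0r expr0n /=.
    rewrite /mean ler_pdivrMr ?ltr0n // mul0r => S0.
    have : \sum_i spectral_norm (hess (f i) (y + t *: u) - hess (f i) y) ^+ 2 == 0.
      by rewrite eq_le S0 sumr_ge0 // => j _; exact: sqr_ge0.
    rewrite psumr_eq0 => [/allP/(_ i)|j _]; last exact: sqr_ge0.
    by rewrite mem_index_enum sqrf_eq0 => /(_ isT) /eqP.
  rewrite L0 !mul0r /dphi (eq_mean (Y := fun=> 0)) ?mean_cst // => i.
  rewrite -dotvBl -mulmxBr; apply/eqP.
  suff -> : u *m (hess (f i) (y + t *: u) - hess (f i) y) = 0 by rewrite dotv0l.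
  apply/eqP; rewrite -enorm_eq0 eq_le enorm_ge0 andbT.
  by rewrite (le_trans (enorm_mulmx _ _)) // H mul0r.
have L_gt0 : 0 < L by rewrite lt_neqAle eq_sym L_neq0 L_ge0.
pose al := L * (t * enorm u); have al0 : 0 < al by rewrite !mulr_gt0.
pose b i := spectral_norm (hess (f i) (y + t *: u) - hess (f i) y).
have mb : mean (fun i => b i ^+ 2) <= al ^+ 2.
  have := mean_hess_sqr (y + t *: u) y.
  by rewrite {2}[y + _]addrC addrK enormZ gtr0_norm.
(* Cauchy-Schwarz for the mean in Young form: al bounds the root mean square of b, and W is that of
   |Z|. The weights divide by both, hence the separate cases u = 0 and L = 0. *)
apply: (@le_trans _ _ (mean (fun i => enorm u *
    (W / (2 * al) * b i ^+ 2 + al / (2 * W) * enorm (Z i) ^+ 2)))).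
  apply: ler_mean => i; rewrite -dotvBl -mulmxBr.
  rewrite (le_trans (dotv_le_enorm _ _)) //.
  apply: (@le_trans _ _ (b i * enorm u * enorm (Z i))).
    by rewrite ler_wpM2r ?enorm_ge0 // enorm_mulmx.
  rewrite mulrAC mulrC ler_pM2l // -subr_ge0.
  have -> : W / (2 * al) * b i ^+ 2 + al / (2 * W) * enorm (Z i) ^+ 2 - b i * enorm (Z i)
      = (W * b i - al * enorm (Z i)) ^+ 2 / (2 * al * W).
    by field; rewrite !gt_eqF.
  by rewrite divr_ge0 ?sqr_ge0 // !mulr_ge0 // ltW.
rewrite meanZ meanD !meanZ -/m mW.
apply: (@le_trans _ _ (enorm u * (W / (2 * al) * al ^+ 2 + al / (2 * W) * W ^+ 2))).
  by rewrite ler_wpM2l ?enorm_ge0 // lerD2r ler_wpM2l // divr_ge0 ?mulr_ge0 // ltW.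
rewrite le_eqVlt; apply/orP; left; apply/eqP; rewrite /al; field.
by rewrite !gt_eqF.
Qed.

Lemma avg_grad_remainder y u :
  avg (grad_remainder y u) = grad F (y + u) - grad F y - u *m hess F y.
Proof. by rewrite !avgB -mulmx_avg !grad_objective hess_objective. Qed.

Lemma objective_grad_remainder x h :
  enorm (grad F (x + h) - grad F x - h *m hess F x) <= L / 2 * enorm h ^+ 2.
Proof.
rewrite -avg_grad_remainder (le_trans (enorm_avg _)) //.
rewrite -(@ler_pXn2r _ 2) ?nnegrE ?mulr_ge0 ?divr_ge0 ?exprn_ge0 ?enorm_ge0 //.
  by rewrite (le_trans (mean_sqr_le _ card_gt0)) // mean_grad_remainder_sqr.
by apply: sumr_ge0 => i _; exact: enorm_ge0.
Qed.

Lemma objective_cubic_bound x h :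
  F (x + h) <= F x + dotv (grad F x) h + 1 / 2 * dotv (h *m hess F x) h
               + L / 6 * enorm h ^+ 3.
Proof.
pose a := dotv (grad F x) h; pose b := dotv (h *m hess F x) h.
pose phi t := F (x + t *: h) - (a * t + b / 2 * t ^+ 2).
pose dphi t := dotv (grad F (x + t *: h)) h - (a + b * t).
have dP (t : R) : is_derive t (1 : R) phi (dphi t).
  exact: is_deriveB (is_derive_line_grad x h t twice_differentiable_objective)
                    (is_derive_quadratic a b t).
have := @mvt_pow_le _ phi dphi (L / 6 * enorm h ^+ 3) 2 dP.
rewrite /phi scale1r scale0r addr0 expr1n expr0n /= !mulr1 !mulr0 addr0 subr0.
move=> H; suff /H : forall t, 0 < t < 1 ->
    dphi t <= L / 6 * enorm h ^+ 3 * (3%:R * t ^+ 2) by rewrite /a /b; lra.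
move=> t /andP[t0 t1]; rewrite /dphi.
have := dotv_le_enorm (grad F (x + t *: h) - grad F x - (t *: h) *m hess F x) h.
have := ler_wpM2r (enorm_ge0 h) (objective_grad_remainder x (t *: h)).
rewrite !dotvBl -scalemxAl dotvZl -/a -/b enormZ gtr0_norm //.
by lra.
Qed.

End FiniteSumSmoothness.

(** * Moments of the errors of the two estimators *)

Section Estimators.
Context {R : realType} {d n : nat} (f : 'I_n -> 'rV[R]_d -> R) (L : R).
Hypotheses (n_gt0 : (0 < n)%N) (L_ge0 : 0 <= L) (smooth : third_moment_smooth f L).
Implicit Types (xhat x : 'rV[R]_d).

Local Notation F := (objective f).

Let card_gt0 : (0 < #|'I_n|)%N. Proof. by rewrite card_ord. Qed.

(** The Hessian correction in the estimator turns the sampled quantities into first-order Taylor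
    remainders of the component gradients, so that the error is quadratic in the distance to the
    snapshot. *)
Lemma grad_estimator_error xhat x b (I : b.-tuple 'I_n) :
  grad_estimator f xhat x I - grad F x
  = b%:R^-1 *: (\sum_(j < b) grad_remainder f xhat (x - xhat) (tnth I j))
    - avg (grad_remainder f xhat (x - xhat)).
Proof.
have zmod_eq (V : zmodType) (p a q r c : V) :
    p + a - (q - r) - c = p - q - (c - a - r).
  by rewrite !opprB !addrA [LHS](ACl (1*4*3*2*5))%AC.
rewrite (avg_grad_remainder smooth) [xhat + _]addrC subrK.
under [in RHS]eq_bigr do rewrite /grad_remainder [xhat + _]addrC subrK.
rewrite /grad_estimator !big_tuple [in RHS]sumrB -mulmx_sumr scalerBr mulmxBr.
rewrite -scalemxAr.
exact: zmod_eq.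
Qed.

Lemma hess_estimator_error xhat x b (J : b.-tuple 'I_n) :
  hess_estimator f xhat x J - hess F x
  = b%:R^-1 *: (\sum_(j < b) (hess (f (tnth J j)) x - hess (f (tnth J j)) xhat))
    - avg (fun i => hess (f i) x - hess (f i) xhat).
Proof.
rewrite /hess_estimator big_tuple avgB.
rewrite (hess_objective smooth x).
rewrite (hess_objective smooth xhat).
rewrite opprB.
by rewrite addrA.
Qed.

Lemma mean_tuple_sum (V : zmodType) (T : finType) b (Z : T -> V) (phi : V -> R) :
  mean (fun I : b.-tuple T => phi (\sum_(j < b) Z (tnth I j)))
  = mean (fun J : {ffun 'I_b -> T} => phi (\sum_j Z (J j))).
Proof.
rewrite mean_tuple; apply: eq_mean => J; congr phi.
by apply: eq_bigr => j _; rewrite tnth_mktuple.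
Qed.

Lemma grad_estimator_variance xhat x b : (0 < b)%N ->
  mean (fun I : b.-tuple 'I_n => enorm (grad_estimator f xhat x I - grad F x) ^+ 2)
  <= b%:R^-1 * (L / 2 * enorm (x - xhat) ^+ 2) ^+ 2.
Proof.
move=> b0; under eq_mean do rewrite grad_estimator_error.
pose Z := grad_remainder f xhat (x - xhat).
rewrite (mean_tuple_sum b Z (fun S => enorm (b%:R^-1 *: S - avg Z) ^+ 2)).
apply: le_trans (batch_variance Z card_gt0 b0) _.
rewrite ler_wpM2l ?invr_ge0 //.
exact: mean_grad_remainder_sqr n_gt0 L_ge0 smooth xhat (x - xhat).
Qed.

Lemma hess_estimator_third_moment xhat x b k : (0 < b)%N -> (1 < k)%N ->
  (d <= 4 ^ k)%N ->
  mean (fun J : b.-tuple 'I_n =>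
    spectral_norm (hess_estimator f xhat x J - hess F x) ^+ 3)
  <= 16 * Num.sqrt (16 * k%:R / b%:R) ^+ 3 * (L * enorm (x - xhat)) ^+ 3.
Proof.
move=> b0 k1 dk; under eq_mean do rewrite hess_estimator_error.
pose B i := hess (f i) x - hess (f i) xhat.
have symB i : (B i)^T = B i.
  by rewrite /B raddfB; congr (_ - _); exact: (hess_component_sym n_gt0 L_ge0 smooth).
rewrite (mean_tuple_sum b B (fun S => spectral_norm (b%:R^-1 *: S - avg B) ^+ 3)).
apply: le_trans (batch_matrix_third_moment card_gt0 b0 k1 dk symB) _.
rewrite ler_wpM2l ?mulr_ge0 ?exprn_ge0 ?sqrtr_ge0 //.
exact: mean_hess_cube L_ge0 smooth x xhat.
Qed.

Lemma hess_estimator_sym xhat x b (J : b.-tuple 'I_n) :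
  (hess_estimator f xhat x J)^T = hess_estimator f xhat x J.
Proof.
rewrite /hess_estimator raddfD; congr (_ + _); last first.
  exact: (hess_objective_sym n_gt0 L_ge0 smooth).
rewrite /= linearZ /=; congr (_ *: _); rewrite raddf_sum; apply: eq_bigr => i _.
by rewrite raddfB; congr (_ - _); exact: (hess_component_sym n_gt0 L_ge0 smooth).
Qed.

End Estimators.

(** A Weyl-type perturbation bound. In its use A and B are the Hessians at the new and the old
    point, and U is the estimate of B. *)
Lemma quad_form_shift (R : realType) d (A B U : 'M[R]_d) (u : 'rV[R]_d) (a b : R) :
  spectral_norm (A - B) <= a -> 0 <= dotv (u *m U) u + b * enorm u ^+ 2 ->
  - ((a + b + spectral_norm (U - B)) * enorm u ^+ 2) <= dotv (u *m A) u.
Proof.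
move=> /(ler_wpM2r (sqr_ge0 (enorm u))) Ha Hb.
have := quad_form_le u (U - B); rewrite ler_norml => /andP[_].
have := quad_form_le u (A - B); rewrite ler_norml => /andP[+ _].
by rewrite !mulmxBr !dotvBl; lra.
Qed.

(** * Effect of one step with estimated derivatives *)

Section OneStep.
Context {R : realType} {d n : nat} (f : 'I_n -> 'rV[R]_d -> R) (L : R).
Hypotheses (n_gt0 : (0 < n)%N) (L_gt0 : 0 < L) (smooth : third_moment_smooth f L).
Variables (x v h : 'rV[R]_d) (U : 'M[R]_d).
Hypotheses (symU : U^T = U) (minh : cubic_argmin (150 * L) v U h).

Local Notation F := (objective f).
Local Notation e := (enorm (v - grad F x)).
Local Notation eta := (spectral_norm (U - hess F x)).

Let L_ge0 : 0 <= L := ltW L_gt0.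
Let M_ge0 : 0 <= 150 * L. Proof. by rewrite mulr_ge0. Qed.

(** 112/3 = 150/12 + 150/6 - 1/6: the decrease of the model, the penalty that the model contains and
    F does not, and the Taylor remainder of F. *)
Lemma step_decrease :
  F (x + h) <= F x - 112 / 3 * L * enorm h ^+ 3 + e * enorm h
               + eta * enorm h ^+ 2 / 2.
Proof.
have := objective_cubic_bound n_gt0 L_ge0 smooth x h.
have := cubic_argmin_decrease M_ge0 symU minh.
have := dotv_le_enorm (- (v - grad F x)) h.
have := quad_form_le h (U - hess F x); rewrite ler_norml => /andP[+ _].
rewrite enormN dotvNl dotvBl mulmxBr dotvBl /cubic_model.
by lra.
Qed.

(** By the first-order condition the new gradient is a Taylor remainder, minus the two estimation
    errors, minus the penalty term of norm 75 L |h|^2; 151/2 = 75 + 1/2. *)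
Lemma step_grad :
  enorm (grad F (x + h)) <= 151 / 2 * L * enorm h ^+ 2 + eta * enorm h + e.
Proof.
have fo := cubic_argmin_first_order M_ge0 symU minh.
pose r := grad F (x + h) - grad F x - h *m hess F x.
have -> : grad F (x + h) = r - (v - grad F x) - h *m (U - hess F x)
                           - (150 * L / 2 * enorm h) *: h.
  have -> : (150 * L / 2 * enorm h) *: h = - (v + h *m U).
    by apply/eqP; rewrite -addr_eq0 addrC fo.
  rewrite /r mulmxBr.
  set a := grad F (x + h); set b := grad F x; set c := h *m U; set p := h *m _.
  by apply/rowP => i; move: a b c p v => a b c p v'; rewrite !mxE; ring.
have := objective_grad_remainder n_gt0 L_ge0 smooth x h; rewrite -/r => Hr.
have Hh : enorm ((150 * L / 2 * enorm h) *: h) = 75 * L * enorm h ^+ 2.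
  rewrite enormZ ger0_norm; first by field.
  by rewrite !mulr_ge0 ?invr_ge0 ?enorm_ge0.
have H1 := enorm_mulmx h (U - hess F x).
rewrite -(enormN (v - _)).
have := enormD (r - (v - grad F x) - h *m (U - hess F x))
               (- ((150 * L / 2 * enorm h) *: h)).
have := enormD (r - (v - grad F x)) (- (h *m (U - hess F x))).
have := enormD r (- (v - grad F x)).
by rewrite !(enormN (_ *m _)) !(enormN (_ *: _)) Hh; lra.
Qed.

(** 76 = 150/2 + 1: the curvature allowed by the second-order condition plus the change of the
    Hessian over the step. *)
Lemma step_lambda_min :
  - (76 * L * enorm h + eta) <= lambda_min (hess F (x + h)).
Proof.
apply: lambda_min_ge => [|u].
  by rewrite addr_ge0 ?mulr_ge0 ?spectral_norm_ge0 ?enorm_ge0.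
have := hess_objective_lipschitz n_gt0 L_ge0 smooth (x + h) x.
have -> : x + h - x = h by rewrite addrC addKr.
move=> /quad_form_shift /(_ (cubic_argmin_second_order u M_ge0 symU minh)).
by apply: le_trans; rewrite lerN2 ler_wpM2r ?sqr_ge0 //; lra.
Qed.

End OneStep.

(** * Scalar inequalities of Young type for one step *)

Section StepInequalities.
Context {R : realType}.

(* At rho = 0 the gradient error e vanishes, so that the junk value of
   e ^+ 2 / (L * rho) is the correct one. *)
Lemma step_decrease_young (L e eta h rho : R) : 0 < L -> 0 <= e -> 0 <= eta ->
  0 <= h -> 0 <= rho -> (rho = 0 -> e = 0) ->
  e * h + eta * h ^+ 2 / 2
  <= 2 / 3 * L * h ^+ 3 + 1 / 6 * L * rho ^+ 3 + e ^+ 2 / (L * rho) / 2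
     + eta ^+ 3 / (6 * L ^+ 2).
Proof.
move=> L0 e0 eta0 h0 rho0 e_rho.
have H1 : e * h <= 1 / 3 * L * h ^+ 3 + 1 / 6 * L * rho ^+ 3 + e ^+ 2 / (L * rho) / 2.
  have [r0|r_neq0] := eqVneq rho 0.
    rewrite e_rho // mul0r expr0n /= mul0r mul0r addr0.
    by rewrite addr_ge0 // !mulr_ge0 ?exprn_ge0 ?invr_ge0 // ltW.
  have r0 : 0 < rho by rewrite lt_neqAle eq_sym r_neq0.
  have Lr : 0 < L * rho by rewrite mulr_gt0.
  set q := e ^+ 2 / (L * rho).
  (* The weight L rho is fixed before the batch is drawn; the leftover rho h^2 is split by 3 rho h^2
     <= rho^3 + 2 h^3. *)
  have H2 : e * h <= q / 2 + L * rho * h ^+ 2 / 2.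
    rewrite -subr_ge0.
    have -> : q / 2 + L * rho * h ^+ 2 / 2 - e * h
            = (e - L * rho * h) ^+ 2 / (2 * (L * rho)).
      by rewrite /q; field; rewrite !gt_eqF.
    by rewrite divr_ge0 ?sqr_ge0 // mulr_ge0 // ltW.
  have : 0 <= L * ((rho - h) ^+ 2 * (rho + 2 * h)).
    by rewrite pmulr_rge0 // mulr_ge0 ?sqr_ge0 //; lra.
  by lra.
have H2 : eta * h ^+ 2 / 2 <= 1 / 3 * L * h ^+ 3 + eta ^+ 3 / (6 * L ^+ 2).
  pose c := eta / L; have c0 : 0 <= c by rewrite divr_ge0 // ltW.
  have etaE : eta = L * c by rewrite /c; field; rewrite gt_eqF.
  rewrite etaE (_ : (L * c) ^+ 3 / (6 * L ^+ 2) = L * c ^+ 3 / 6); last first.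
    by field; rewrite gt_eqF.
  have : 0 <= L * ((c - h) ^+ 2 * (c + 2 * h)).
    by rewrite pmulr_rge0 // mulr_ge0 ?sqr_ge0 //; lra.
  by lra.
by lra.
Qed.

Lemma powR32 (a : R) : 0 <= a -> a `^ (3 / 2) = Num.sqrt a ^+ 3.
Proof.
move=> a0; rewrite -powR_mulrn ?sqrtr_ge0 // -powR12_sqrt // -powRrM.
by congr (_ `^ _); field.
Qed.

(** The power 3/2 is the cube of the square root. As 151/2 <= 9^2, the root of the bound is at most
    s (9 h + eta / L) + sqrt e; [cube_add_le], applied twice, gives the factor 16. *)
Lemma step_grad_powR (L g e eta h rho : R) : 0 < L -> 0 <= g -> 0 <= e ->
  0 <= eta -> 0 <= h -> 0 <= rho -> (rho = 0 -> e = 0) ->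
  g <= 151 / 2 * L * h ^+ 2 + eta * h + e ->
  g `^ (3 / 2) <= Num.sqrt L ^+ 3 * (16 * ((9 * h) ^+ 3 + (eta / L) ^+ 3) + rho ^+ 3)
                  + 3 * Num.sqrt L * (e ^+ 2 / (L * rho)).
Proof.
move=> L0 g0 e0 eta0 h0 rho0 e_rho gle.
set s := Num.sqrt L; have s0 : 0 < s by rewrite sqrtr_gt0.
have sL : s ^+ 2 = L by rewrite sqr_sqrtr // ltW.
pose c := eta / L; have c0 : 0 <= c by rewrite divr_ge0 // ltW.
have etaE : eta = L * c by rewrite /c; field; rewrite gt_eqF.
pose z := Num.sqrt e; have z0 : 0 <= z := sqrtr_ge0 _.
have ez : e = z ^+ 2 by rewrite sqr_sqrtr.
have a0 : 0 <= s * (9 * h + c) by rewrite pmulr_rge0 //; lra.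
have sg : Num.sqrt g <= s * (9 * h + c) + z.
  rewrite -(@ler_pXn2r _ 2) ?nnegrE ?sqrtr_ge0 ?addr_ge0 // sqr_sqrtr //.
  apply: (le_trans gle); rewrite etaE ez sqrrD exprMn sL.
  have : 0 <= s * (9 * h + c) * z by rewrite mulr_ge0.
  have : 0 <= L * (h * c) by rewrite pmulr_rge0 // mulr_ge0.
  have : 0 <= L * h ^+ 2 by rewrite pmulr_rge0 // sqr_ge0.
  have : 0 <= L * c ^+ 2 by rewrite pmulr_rge0 // sqr_ge0.
  by lra.
rewrite powR32 //.
apply: (@le_trans _ _ ((s * (9 * h + c) + z) ^+ 3)).
  by rewrite lerXn2r ?nnegrE ?sqrtr_ge0 ?addr_ge0.
apply: (le_trans (cube_add_le a0 z0)).
have h9 : 0 <= 9 * h by rewrite mulr_ge0.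
have := ler_wpM2l (exprn_ge0 3 (ltW s0)) (cube_add_le h9 c0).
(* Young for e^(3/2): the gap is a quartic in z with a double root at z = s rho. *)
have : z ^+ 3 <= 3 / 4 * s * (e ^+ 2 / (L * rho)) + s ^+ 3 * rho ^+ 3 / 4.
  have [r0|r_neq0] := eqVneq rho 0.
    have -> : z = 0 by rewrite /z e_rho // sqrtr0.
    by rewrite r0 !expr0n /= !(mulr0, invr0, mul0r, addr0).
  have r0 : 0 < rho by rewrite lt_neqAle eq_sym r_neq0.
  rewrite -subr_ge0 ez -sL.
  have -> : 3 / 4 * s * ((z ^+ 2) ^+ 2 / (s ^+ 2 * rho)) + s ^+ 3 * rho ^+ 3 / 4 - z ^+ 3
    = (z - s * rho) ^+ 2 * (3 * z ^+ 2 + 2 * (s * rho) * z + (s * rho) ^+ 2)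
      / (4 * s * rho).
    by field; rewrite !gt_eqF.
  have sr0 : 0 <= s * rho by rewrite ltW // mulr_gt0.
  apply: divr_ge0; last by lra.
  apply: mulr_ge0; first exact: sqr_ge0.
  have := mulr_ge0 sr0 z0; have := sqr_ge0 z; have := sqr_ge0 (s * rho).
  by lra.
by rewrite exprMn -/c; lra.
Qed.

Lemma step_lambda_cube (L l eta h : R) : 0 < L -> 0 <= eta -> 0 <= h ->
  - (76 * L * h + eta) <= l ->
  - (l ^+ 3 / L `^ (3 / 2))
  <= Num.sqrt L ^+ 3 * (4 * ((76 * h) ^+ 3 + (eta / L) ^+ 3)).
Proof.
move=> L0 eta0 h0 lle; rewrite powR32 ?(ltW L0) //.
set s := Num.sqrt L; have s0 : 0 < s by rewrite sqrtr_gt0.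
have sL : s ^+ 2 = L by rewrite sqr_sqrtr // ltW.
pose c := eta / L; have c0 : 0 <= c by rewrite divr_ge0 // ltW.
have etaE : eta = L * c by rewrite /c; field; rewrite gt_eqF.
rewrite -mulNr ler_pdivrMr ?exprn_gt0 //.
have h76 : 0 <= 76 * h by rewrite mulr_ge0.
have L3 : 0 <= L ^+ 3 by rewrite exprn_ge0 // ltW.
have E : s ^+ 3 * s ^+ 3 = L ^+ 3 by rewrite -exprMn -expr2 sL.
have cubeN : - l ^+ 3 <= (L * (76 * h + c)) ^+ 3.
  set y := L * _; have y0 : 0 <= y by rewrite pmulr_rge0 //; lra.
  have ly : - l <= y by move: lle; rewrite /y etaE; lra.
  have [l0|/ltW l0] := leP 0 l.
    by rewrite (le_trans (_ : _ <= 0)) ?exprn_ge0 // oppr_le0 exprn_ge0.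
  have -> : - l ^+ 3 = (- l) ^+ 3 by ring.
  by rewrite lerXn2r ?nnegrE // oppr_ge0.
apply: (le_trans cubeN); rewrite exprMn.
by rewrite -/c [leRHS]mulrAC E ler_wpM2l // cube_add_le.
Qed.

End StepInequalities.

(** * Expectations along a run of the algorithm *)

Section Run.
Context {R : realType} {d n : nat} (f : 'I_n -> 'rV[R]_d -> R) (L Delta : R).
Context {S T bg bh : nat} (k : nat) (x0 : 'rV[R]_d).
Variable x : batches n S T bg bh -> nat -> nat -> 'rV[R]_d.

Local Notation F := (objective f).

Hypotheses (n_gt0 : (0 < n)%N) (L_gt0 : 0 < L) (smooth : third_moment_smooth f L).
Hypotheses (S_gt0 : (0 < S)%N) (T_gt0 : (0 < T)%N).
Hypotheses (bg_gt0 : (0 < bg)%N) (bh_gt0 : (0 < bh)%N).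
Hypotheses (k_gt1 : (1 < k)%N) (d_le : (d <= 4 ^ k)%N).
(** With r = T rho these make the second moment of the gradient error at most L^2 rho^4 and the
    third moment of the Hessian error at most 16 (L rho)^3. *)
Hypotheses (T_bg : (T ^ 4 <= 4 * bg)%N) (T_bh : (16 * k * T ^ 2 <= bh)%N).
Hypothesis gap : forall y, F x0 - F y <= Delta.
Hypothesis run : SVRC_run f (150 * L) x0 x.

Let L_ge0 : 0 <= L := ltW L_gt0.

Local Notation W := (batches n S T bg bh).
Local Notation st := ('I_S * 'I_T)%type.
Local Notation batch := (bg.-tuple 'I_n * bh.-tuple 'I_n)%type.

Implicit Types (w : W) (p : st).

Let card_batch : (0 < #|{: batch}|)%N.
Proof. by rewrite card_prod !card_tuple card_ord muln_gt0 !expn_gt0 n_gt0. Qed.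

Let card_W : (0 < #|W|)%N.
Proof. by rewrite card_ffun expn_gt0 card_batch. Qed.

Let T_neq0 : T%:R != 0 :> R. Proof. by rewrite pnatr_eq0 -lt0n. Qed.

Let step (w : W) (p : st) : R := enorm (x w p.1 p.2.+1 - x w p.1 p.2).

(** Dividing by T makes rho at most the average step length of the epoch. *)
Let rho (w : W) (p : st) : R := enorm (x w p.1 p.2 - x w p.1 0%N) / T%:R.

(** The batch is an argument of its own: the run has b = w p, and resampling replaces it by an
    independent draw with the iterates unchanged. *)
Let e (w : W) (p : st) (b : batch) : R :=
  enorm (grad_estimator f (x w p.1 0%N) (x w p.1 p.2) b.1 - grad F (x w p.1 p.2)).

Let eta (w : W) (p : st) (b : batch) : R :=
  spectral_norm (hess_estimator f (x w p.1 0%N) (x w p.1 p.2) b.2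
                 - hess F (x w p.1 p.2)).

Let step_ge0 w p : 0 <= step w p. Proof. exact: enorm_ge0. Qed.
Let rho_ge0 w p : 0 <= rho w p. Proof. by rewrite divr_ge0 ?enorm_ge0. Qed.
Let e_ge0 w p b : 0 <= e w p b. Proof. exact: enorm_ge0. Qed.
Let eta_ge0 w p b : 0 <= eta w p b. Proof. exact: spectral_norm_ge0. Qed.

Let distE w p : enorm (x w p.1 p.2 - x w p.1 0%N) = rho w p * T%:R.
Proof. by rewrite /rho mulfVK. Qed.

(** At the snapshot, in particular at the start of every epoch, the estimator returns the exact
    gradient; this legitimates the weights 1 / (L rho) at rho = 0. *)
Let e_eq0 w p b : rho w p = 0 -> e w p b = 0.
Proof.
move=> r0; have : x w p.1 p.2 - x w p.1 0%N = 0.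
  by apply/eqP; rewrite -enorm_eq0 distE r0 mul0r.
move=> /eqP; rewrite subr_eq0 => /eqP E.
rewrite /e /grad_estimator E subrr mul0mx subr0 big1 => [|i _]; last exact: subrr.
by rewrite scaler0 add0r subrr enorm0.
Qed.

(** The iterate at time p.2 is computed before the batch at p is drawn, so t = p.2 is still
    included. This is what permits resampling at p. *)
Lemma update_past (w : W) (p : st) (b : batch) t : (t <= p.2)%N ->
  x (update w p b) p.1 t = x w p.1 t.
Proof.
move=> tp; have [_ _ _ H] := run.
apply: H => //; first exact: leq_trans tp (ltnW (ltn_ord _)).
move=> s' t' past; rewrite ffunE; case: eqP => // E.
move: past tp; rewrite -E /= ltnn eqxx /=.
by move=> lt_t' le_t'; have := leq_trans lt_t' le_t'; rewrite ltnn.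
Qed.

(** Given the past, L rho is a constant that comes out of the average over the fresh batch, and the
    variance bound divided by it leaves L rho^3. *)
Let mean_e p :
  mean (fun w => e w p (w p) ^+ 2 / (L * rho w p)) <= mean (fun w => L * rho w p ^+ 3).
Proof.
rewrite (@mean_resample R _ _ p (fun w b => e w p b ^+ 2 / (L * rho w p)) card_batch);
  last by move=> w b b'; rewrite /e /rho !update_past.
apply: ler_mean => w; rewrite (eq_mean (Y := fun b => (L * rho w p)^-1 * e w p b ^+ 2));
  last by move=> b; rewrite mulrC.
rewrite meanZ; have [r0|r_neq0] := eqVneq (rho w p) 0.
  (* Both sides are 0, the left one because the inverse of 0 is 0. *)
  by rewrite r0 mulr0 invr0 mul0r expr0n /= mulr0.
have r_gt0 : 0 < rho w p by rewrite lt_neqAle eq_sym r_neq0 rho_ge0.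
have Lr : 0 < L * rho w p by rewrite mulr_gt0.
rewrite mulrC ler_pdivrMr //.
rewrite (@mean_pair_fst R _ _ (fun I => enorm (grad_estimator f (x w p.1 0%N)
  (x w p.1 p.2) I - grad F (x w p.1 p.2)) ^+ 2)); last first.
  by rewrite card_tuple card_ord expn_gt0 n_gt0.
apply: (le_trans (grad_estimator_variance n_gt0 L_ge0 smooth _ _ bg_gt0)).
rewrite distE; set r := rho w p.
have -> : L * r ^+ 3 * (L * r) = 4 * bg%:R * (bg%:R^-1 * (L / 2 * r ^+ 2) ^+ 2).
  by field; rewrite pnatr_eq0 -lt0n.
have -> : bg%:R^-1 * (L / 2 * (r * T%:R) ^+ 2) ^+ 2
    = T%:R ^+ 4 * (bg%:R^-1 * (L / 2 * r ^+ 2) ^+ 2).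
  by field; rewrite pnatr_eq0 -lt0n.
have c0 : 0 <= bg%:R^-1 * (L / 2 * r ^+ 2) ^+ 2.
  by apply: mulr_ge0; [rewrite invr_ge0 | exact: sqr_ge0].
by apply: (ler_wpM2r c0); rewrite -natrX -natrM ler_nat.
Qed.

Let mean_eta p :
  mean (fun w => eta w p (w p) ^+ 3) <= mean (fun w => 16 * (L * rho w p) ^+ 3).
Proof.
rewrite (@mean_resample R _ _ p (fun w b => eta w p b ^+ 3) card_batch);
  last by move=> w b b'; rewrite /eta !update_past.
apply: ler_mean => w.
rewrite (@mean_pair_snd R _ _ (fun J => spectral_norm (hess_estimator f (x w p.1 0%N)
  (x w p.1 p.2) J - hess F (x w p.1 p.2)) ^+ 3)); last first.
  by rewrite card_tuple card_ord expn_gt0 n_gt0.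
apply: (le_trans (hess_estimator_third_moment n_gt0 L_ge0 smooth _ _ bh_gt0 k_gt1 d_le)).
rewrite distE -mulrA ler_pM2l // -exprMn.
set q := Num.sqrt _; have q0 : 0 <= q := sqrtr_ge0 _.
have Lr0 : 0 <= L * rho w p by rewrite mulr_ge0.
have qT : q * T%:R <= 1.
  rewrite -(@ler_pXn2r _ 2) ?nnegrE ?mulr_ge0 // expr1n exprMn sqr_sqrtr; last first.
    by rewrite divr_ge0 ?mulr_ge0.
  by rewrite mulrAC ler_pdivrMr ?ltr0n // mul1r -natrX -!natrM ler_nat.
have -> : q * (L * (rho w p * T%:R)) = L * rho w p * (q * T%:R) by ring.
have LrT : 0 <= L * rho w p * (q * T%:R) by apply: mulr_ge0 => //; apply: mulr_ge0.
by rewrite lerXn2r ?nnegrE // ler_piMr.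
Qed.

Let h3 p := mean (fun w => step w p ^+ 3).
Let rho3 p := mean (fun w => rho w p ^+ 3).

Let h3_ge0 p : 0 <= h3 p.
Proof. by apply: mean_ge0 => w; rewrite exprn_ge0. Qed.

Let mean_eE p : mean (fun w => e w p (w p) ^+ 2 / (L * rho w p)) <= L * rho3 p.
Proof. by rewrite -meanZ; exact: mean_e. Qed.

Let mean_etaE p : mean (fun w => eta w p (w p) ^+ 3) <= 16 * L ^+ 3 * rho3 p.
Proof.
apply: (le_trans (mean_eta p)); rewrite -meanZ; apply: ler_mean => w.
by rewrite exprMn mulrA.
Qed.

Let argmin w (p : st) : cubic_argmin (150 * L)
  (grad_estimator f (x w p.1 0%N) (x w p.1 p.2) (w p).1)
  (hess_estimator f (x w p.1 0%N) (x w p.1 p.2) (w p).2)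
  (x w p.1 p.2.+1 - x w p.1 p.2).
Proof. by have [_ _ H _] := run; case: p => s t; exact: H. Qed.

Let next w (p : st) :
  x w p.1 p.2 + (x w p.1 p.2.+1 - x w p.1 p.2) = x w p.1 p.2.+1.
Proof. by rewrite addrC subrK. Qed.

(** 110/3 = 112/3 - 2/3 after Young, and 10/3 = 1/6 + 1/2 + 16/6 collects the rho^3 terms of Young,
    the gradient error and the Hessian error. *)
Let mean_decrease p :
  mean (fun w => F (x w p.1 p.2.+1) - F (x w p.1 p.2))
  <= - (110 / 3 * L * h3 p) + 10 / 3 * L * rho3 p.
Proof.
apply: (@le_trans _ _ (mean (fun w => - (110 / 3 * L) * step w p ^+ 3
    + (1 / 6 * L * rho w p ^+ 3 + (1 / 2 * (e w p (w p) ^+ 2 / (L * rho w p))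
       + (6 * L ^+ 2)^-1 * eta w p (w p) ^+ 3))))).
  apply: ler_mean => w.
  have symU := hess_estimator_sym n_gt0 L_ge0 smooth (x w p.1 0%N) (x w p.1 p.2) (w p).2.
  have := step_decrease n_gt0 L_gt0 smooth (x w p.1 p.2) symU (argmin w p); rewrite next.
  rewrite -/(step w p) -/(e w p (w p)) -/(eta w p (w p)).
  have := step_decrease_young L_gt0 (e_ge0 w p (w p)) (eta_ge0 w p (w p))
    (step_ge0 w p) (rho_ge0 w p) (@e_eq0 w p (w p)).
  by lra.
rewrite !meanD !meanZ -/(h3 p) -/(rho3 p).
have := mean_eE p; have := mean_etaE p.
have c0 : 0 <= (6 * L ^+ 2)^-1 by rewrite invr_ge0 mulr_ge0 ?sqr_ge0.
move=> /(ler_wpM2l c0).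
have -> : (6 * L ^+ 2)^-1 * (16 * L ^+ 3 * rho3 p) = 8 / 3 * L * rho3 p.
  by field; rewrite gt_eqF.
by lra.
Qed.

Let mu y := Num.max (enorm (grad F y) `^ (3 / 2))
  (- (lambda_min (hess F y) ^+ 3 / L `^ (3 / 2))).

(** The maximum is bounded by the sum of the two nonnegative bounds. In 324 = 1 + 3 + 20 * 16 the
    last term is the Hessian error, with 20 = 16 + 4 from the gradient and the curvature part. *)
Let mean_mu p :
  mean (fun w => mu (x w p.1 p.2.+1))
  <= Num.sqrt L ^+ 3 * ((16 * 9 ^+ 3 + 4 * 76 ^+ 3) * h3 p + 324 * rho3 p).
Proof.
set s := Num.sqrt L; have s0 : 0 < s by rewrite sqrtr_gt0.
have sL : s ^+ 2 = L by rewrite sqr_sqrtr.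
apply: (@le_trans _ _ (mean (fun w => s ^+ 3 * (16 * 9 ^+ 3 + 4 * 76 ^+ 3) * step w p ^+ 3
    + (s ^+ 3 * rho w p ^+ 3 + (3 * s * (e w p (w p) ^+ 2 / (L * rho w p))
       + 20 * s ^+ 3 / L ^+ 3 * eta w p (w p) ^+ 3))))).
  apply: ler_mean => w.
  have symU := hess_estimator_sym n_gt0 L_ge0 smooth (x w p.1 0%N) (x w p.1 p.2) (w p).2.
  have Hg := step_grad n_gt0 L_gt0 smooth (x w p.1 p.2) symU (argmin w p).
  have Hl := step_lambda_min n_gt0 L_gt0 smooth (x w p.1 p.2) symU (argmin w p).
  rewrite next in Hg Hl.
  rewrite -/(step w p) -/(e w p (w p)) -/(eta w p (w p)) in Hg Hl.
  have {}Hg := step_grad_powR L_gt0 (enorm_ge0 _) (e_ge0 w p (w p))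
    (eta_ge0 w p (w p)) (step_ge0 w p) (rho_ge0 w p) (@e_eq0 w p (w p)) Hg.
  have {}Hl := step_lambda_cube L_gt0 (eta_ge0 w p (w p)) (step_ge0 w p) Hl.
  rewrite -/s in Hg Hl.
  have s3 : 0 <= s ^+ 3 by rewrite exprn_ge0 // ltW.
  have h9 : 0 <= 9 * step w p by rewrite mulr_ge0.
  have h76 : 0 <= 76 * step w p by rewrite mulr_ge0.
  have cL : 0 <= eta w p (w p) / L by rewrite divr_ge0.
  have q0 : 0 <= e w p (w p) ^+ 2 / (L * rho w p).
    by apply: divr_ge0; [exact: sqr_ge0 | exact: mulr_ge0].
  have A0 : 0 <= s ^+ 3 * (16 * ((9 * step w p) ^+ 3 + (eta w p (w p) / L) ^+ 3)
      + rho w p ^+ 3) + 3 * s * (e w p (w p) ^+ 2 / (L * rho w p)).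
    apply: addr_ge0; last by apply: mulr_ge0 => //; lra.
    apply: (mulr_ge0 s3); apply: addr_ge0; last exact: exprn_ge0.
    by apply: mulr_ge0 => //; apply: addr_ge0; exact: exprn_ge0.
  have B0 : 0 <= s ^+ 3 * (4 * ((76 * step w p) ^+ 3 + (eta w p (w p) / L) ^+ 3)).
    by do 2 apply: mulr_ge0 => //; apply: addr_ge0; exact: exprn_ge0.
  rewrite /mu ge_max; apply/andP.
  have -> : s ^+ 3 * (16 * 9 ^+ 3 + 4 * 76 ^+ 3) * step w p ^+ 3
    + (s ^+ 3 * rho w p ^+ 3 + (3 * s * (e w p (w p) ^+ 2 / (L * rho w p))
       + 20 * s ^+ 3 / L ^+ 3 * eta w p (w p) ^+ 3))
    = (s ^+ 3 * (16 * ((9 * step w p) ^+ 3 + (eta w p (w p) / L) ^+ 3)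
      + rho w p ^+ 3) + 3 * s * (e w p (w p) ^+ 2 / (L * rho w p)))
      + s ^+ 3 * (4 * ((76 * step w p) ^+ 3 + (eta w p (w p) / L) ^+ 3)).
    by rewrite !expr_div_n; ring.
  split; first by rewrite (le_trans Hg) // lerDl.
  by rewrite (le_trans Hl) // lerDr.
rewrite !meanD !meanZ -/(h3 p) -/(rho3 p).
have s3 : 0 <= 3 * s by rewrite mulr_ge0 // ltW.
have := ler_wpM2l s3 (mean_eE p).
have c0 : 0 <= 20 * s ^+ 3 / L ^+ 3.
  by rewrite divr_ge0 ?exprn_ge0 // mulr_ge0 ?exprn_ge0 // ltW.
have := ler_wpM2l c0 (mean_etaE p).
have -> : 20 * s ^+ 3 / L ^+ 3 * (16 * L ^+ 3 * rho3 p) = 320 * s ^+ 3 * rho3 p.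
  by field; rewrite gt_eqF.
by rewrite -sL; lra.
Qed.

Let dist_le_steps w (p : st) :
  enorm (x w p.1 p.2 - x w p.1 0%N) <= \sum_(t < T) step w (p.1, t).
Proof.
pose a t := enorm (x w p.1 t.+1 - x w p.1 t).
have H (t : nat) : enorm (x w p.1 t - x w p.1 0%N) <= \sum_(j < t) a j.
  elim: t => [|t IH]; first by rewrite subrr enorm0 big_ord0.
  rewrite big_ord_recr /= addrC (le_trans (enorm_triangle (x w p.1 t) _ _)) //.
  by rewrite lerD2l.
apply: (le_trans (H p.2)).
rewrite (big_ord_widen_cond T xpredT a (ltnW (ltn_ord p.2))) /=.
by rewrite [leRHS](bigID (fun j : 'I_T => (j < p.2)%N)) /= lerDl sumr_ge0.
Qed.

(** For every t of an epoch, rho is at most the mean of all its T step lengths, so by convexity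
    rho^3 is at most the mean of their cubes, a bound that does not depend on t. *)
Let sum_rho3_le : mean rho3 <= mean h3.
Proof.
rewrite /rho3 /h3 [leLHS]mean_exchange [leRHS]mean_exchange.
apply: ler_mean => w; rewrite !mean_pair; apply: ler_mean => s /=.
set m := mean (fun u => step w (s, u) ^+ 3).
have cardT : (0 < #|'I_T|)%N by rewrite card_ord.
apply: (@le_trans _ _ (mean (fun _ : 'I_T => m))); last by rewrite mean_cst.
apply: ler_mean => t.
apply: le_trans (mean_cube_le cardT (fun u => step_ge0 w (s, u))).
rewrite lerXn2r ?nnegrE ?rho_ge0 ?mean_ge0 //.
by rewrite /rho /mean card_ord ler_wpM2r ?invr_ge0 //; exact: (dist_le_steps w (s, t)).
Qed.

(** Each snapshot is the last iterate of the previous epoch, so the sum collapses to the difference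
    of F between the final and the initial point. *)
Let telescope w :
  - Delta <= \sum_(s < S) \sum_(t < T) (F (x w s t.+1) - F (x w s t)).
Proof.
have [x00 xS _ _] := run.
have inner s : \sum_(t < T) (F (x w s t.+1) - F (x w s t)) = F (x w s T) - F (x w s 0%N).
  rewrite -(big_mkord xpredT (fun t => F (x w s t.+1) - F (x w s t))).
  by rewrite telescope_sumr.
have H m : (m < S)%N ->
    \sum_(s < m.+1) (F (x w s T) - F (x w s 0%N)) = F (x w m T) - F x0.
  elim: m => [|m IH] mS; first by rewrite big_ord_recl big_ord0 addr0 /= x00.
  rewrite big_ord_recr /= IH ?(ltnW mS) // xS //.
  by ring.
have [m mE] : exists m, S = m.+1 by exists S.-1; rewrite prednK.
have := gap (x w m T); rewrite -lerN2 opprB.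
rewrite -H; last by rewrite mE.
move=> /le_trans; apply; rewrite le_eqVlt; apply/orP; left; apply/eqP.
under [RHS]eq_bigr do rewrite inner.
by rewrite -!(big_mkord xpredT (fun s => F (x w s T) - F (x w s 0%N))) mE.
Qed.

Lemma expect_outE phi :
  expect_out x phi = mean (fun p : st => mean (fun w => phi (x w p.1 p.2.+1))).
Proof. by rewrite /expect_out mean_pair mean_exchange. Qed.

Lemma svrc_expectation_bound :
  expect_out x mu <= 54 * 1000 * Num.sqrt L * Delta / (S%:R * T%:R).
Proof.
have STE : #|{: st}|%:R = S%:R * T%:R :> R by rewrite card_prod !card_ord natrM.
have ST0 : 0 < S%:R * T%:R :> R by rewrite mulr_gt0 ?ltr0n.
have dec : - Delta / (S%:R * T%:R) <= - (110 / 3 * L * mean h3) + 10 / 3 * L * mean rho3.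
  apply: (@le_trans _ _ (mean (fun p : st =>
      mean (fun w => F (x w p.1 p.2.+1) - F (x w p.1 p.2))))).
    rewrite mean_exchange -[leLHS](mean_cst _ card_W); apply: ler_mean => w.
    rewrite /mean STE ler_wpM2r ?invr_ge0 ?(ltW ST0) //.
    rewrite -(pair_bigA _ (fun (s : 'I_S) (t : 'I_T) => F (x w s t.+1) - F (x w s t))) /=.
    exact: telescope.
  rewrite -!meanZ -meanN -meanD; apply: ler_mean => p; exact: mean_decrease.
have hmean : 0 <= mean h3 by apply: mean_ge0.
have Lle := ler_wpM2l L_ge0 sum_rho3_le.
(* The margin is 110/3 - 10/3 = 100/3. *)
have Lh : L * mean h3 <= 3 / 100 * (Delta / (S%:R * T%:R)).
  by move: dec; rewrite mulNr; lra.
set s := Num.sqrt L; have s0 : 0 < s by rewrite sqrtr_gt0.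
have sL : s ^+ 2 = L by rewrite sqr_sqrtr.
rewrite expect_outE.
apply: (@le_trans _ _ (mean (fun p : st => s ^+ 3 *
    ((16 * 9 ^+ 3 + 4 * 76 ^+ 3) * h3 p + 324 * rho3 p)))).
  by apply: ler_mean => p; exact: mean_mu.
rewrite meanZ meanD !meanZ.
(* 16 * 9^3 + 4 * 76^3 + 324 = 1767892, rounded up; multiplied by 3/100 it becomes the 54000 of the
   statement. *)
apply: (@le_trans _ _ (s * (1800 * 1000 * (L * mean h3)))).
  have -> : s ^+ 3 = s * L by rewrite -sL; ring.
  rewrite -[leLHS]mulrA; apply: ler_wpM2l; first exact: ltW.
  by have := mulr_ge0 L_ge0 hmean; lra.
apply: (@le_trans _ _ (s * (1800 * 1000 * (3 / 100 * (Delta / (S%:R * T%:R)))))).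
  by apply: ler_wpM2l; [exact: ltW | lra].
rewrite le_eqVlt; apply/orP; left; apply/eqP; field.
by rewrite !pnatr_eq0 -!lt0n S_gt0 T_gt0.
Qed.

End Run.

(** * Numerical bounds, rounding and fifth roots *)

Section Numerics.
Context {R : realType}.

(** Squaring exp (-1/2) >= 1 - 1/2 and inverting. *)
Lemma expR1_le4 : expR 1 <= 4 :> R.
Proof.
have E : expR 1 = (expR (- (1 / 2)))^-1 ^+ 2 :> R.
  by rewrite -expRN opprK -expRM_natl; congr expR; field.
rewrite E exprVn -[4]invrK lef_pV2 ?posrE ?invr_gt0 ?exprn_gt0 ?expR_gt0 //.
have H := expR_ge1Dx (- (1 / 2) : R).
rewrite (_ : 4^-1 = (1 / 2) ^+ 2 :> R); last by field.
by rewrite lerXn2r ?nnegrE ?expR_ge0 //; lra.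
Qed.

Lemma ln_nat_ge_half d : (2 <= d)%N -> 1 / 2 <= ln d%:R :> R.
Proof.
move=> d2; have d0 : 0 < d%:R :> R by rewrite ltr0n (leq_trans _ d2).
rewrite -ler_expR lnK ?posrE //; apply: (@le_trans _ _ 2); last by rewrite ler_nat.
rewrite -(@ler_pXn2r _ 2) ?nnegrE ?expR_ge0 // -expRM_natl.
rewrite (_ : 2%:R * (1 / 2) = 1 :> R); last by field.
by rewrite (le_trans expR1_le4) // -natrX ler_nat.
Qed.

Lemma exists_pow4_ge d : (2 <= d)%N -> exists k : nat,
  [/\ (1 < k)%N, (d <= 4 ^ k)%N & k%:R <= ln d%:R + 2 :> R].
Proof.
move=> d2; have d0 : 0 < d%:R :> R by rewrite ltr0n (leq_trans _ d2).
have l0 : 0 <= ln d%:R :> R by rewrite (le_trans _ (ln_nat_ge_half d2)).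
have /andP[t1 t2] := truncn_itv l0; set t := Num.truncn _ in t1 t2 *.
(* The integer part of ln d, plus 2: one for d <= e^k <= 4^k, one more to guarantee k > 1. *)
exists t.+2; split => //; last by rewrite -natr1 -[t.+1%:R]natr1; lra.
rewrite -(ler_nat R) natrX -[d%:R]lnK ?posrE //.
apply: (@le_trans _ _ (expR t.+2%:R)).
  by rewrite ler_expR (le_trans (ltW t2)) // ler_nat.
rewrite -[t.+2%:R]mulr1 expRM_natl lerXn2r ?nnegrE ?expR_ge0 //.
exact: expR1_le4.
Qed.

Lemma rounding_le (k : nat) (y : R) : rounding k y -> k%:R <= y + 1.
Proof.
case=> E; rewrite -[k%:R]/((k%:Z)%:~R) E.
  by have /andP[+ _] := floor_itv y; lra.
by have /andP[+ _] := ceil_itv y; rewrite intrD mulrN1z; lra.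
Qed.

Lemma rounding_gt (k : nat) (y : R) : rounding k y -> y < k%:R + 1.
Proof.
case=> E; rewrite -[k%:R]/((k%:Z)%:~R) E.
  by have /andP[_] := floor_itv y; rewrite intrD.
by have /andP[_] := ceil_itv y; lra.
Qed.

(** Integer lower bounds survive rounding down because y < k + 1 is strict. *)
Lemma rounding_ge_nat (m k : nat) (y : R) : rounding k y -> m%:R <= y -> (m <= k)%N.
Proof.
move=> /rounding_gt H my; rewrite -ltnS -(ltr_nat R) -[k.+1%:R]natr1.
exact: le_lt_trans my H.
Qed.

Lemma powR_fifth (a : R) m : 0 <= a -> a `^ (m%:R / 5) = (a `^ (1 / 5)) ^+ m.
Proof.
move=> a0; rewrite -powR_mulrn ?powR_ge0 // -powRrM.
by congr (_ `^ _); field.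
Qed.

Lemma initial_gap_le d n (f : 'I_n -> 'rV[R]_d -> R) x0 (Delta : R) :
  initial_gap f x0 Delta -> forall y, objective f x0 - objective f y <= Delta.
Proof.
move=> gap y; rewrite -lee_fin EFinB; apply: le_trans gap; apply: leeB => //.
by apply: ereal_inf_lbound; exists y.
Qed.

End Numerics.

(** * The prescribed parameters satisfy the conditions of the run *)

Section ParameterBounds.
Context {R : realType} {d n : nat} (T bg bh : nat).
Hypotheses (d_ge2 : (2 <= d)%N) (n_gt0 : (0 < n)%N).
Hypothesis T_round : rounding T (Num.max 2 (n%:R `^ (1 / 5)) : R).
Hypothesis bg_round : rounding bg (5 * Num.max (n%:R `^ (4 / 5)) (2 ^+ 4) : R).
Hypothesis bh_round :
  rounding bh (3000 * Num.max 4 (n%:R `^ (2 / 5)) * ln d%:R ^+ 3 : R).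

Local Notation p := (n%:R `^ (1 / 5) : R).
Local Notation l := (ln d%:R : R).

Lemma fifth_root_pow5 : p ^+ 5 = n%:R.
Proof. by rewrite -powR_fifth // divff ?powRr1. Qed.

Lemma fifth_root_ge1 : 1 <= p.
Proof.
rewrite leNgt; apply/negP => p1.
have : p ^+ 5 < 1 by rewrite exprn_ilt1 ?powR_ge0.
by rewrite fifth_root_pow5 ltNge ler1n n_gt0.
Qed.

Lemma fifth_root_pow4 : n%:R `^ (4 / 5) = p ^+ 4.
Proof. exact: powR_fifth. Qed.

Lemma fifth_root_pow2 : n%:R `^ (2 / 5) = p ^+ 2.
Proof. exact: powR_fifth. Qed.

Lemma epoch_length_ge2 : (2 <= T)%N.
Proof. by apply: rounding_ge_nat T_round _; rewrite le_max lexx. Qed.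

Lemma epoch_length_ge : p <= 2 * T%:R.
Proof.
have := rounding_gt T_round; rewrite gt_max => /andP[_].
have : 2 <= T%:R :> R by rewrite ler_nat epoch_length_ge2.
by lra.
Qed.

Lemma epoch_length_le : p <= 2 /\ T%:R <= 3 :> R \/ 2 <= p /\ T%:R <= 3 / 2 * p.
Proof.
have := rounding_le T_round.
by case: (leP 2 p) => p2 H; [right | left]; split; rewrite ?(ltW p2) //; lra.
Qed.

Lemma grad_batch_gt0 : (0 < bg)%N.
Proof.
apply: rounding_ge_nat bg_round _.
have : (2 ^+ 4 : R) <= Num.max (n%:R `^ (4 / 5)) (2 ^+ 4) by rewrite le_max lexx orbT.
by set m := Num.max _ _; lra.
Qed.

Let l_ge : 1 / 2 <= l. Proof. exact: ln_nat_ge_half. Qed.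

(** Since ln d >= 1/2 even for d = 2, log^3 d dominates a multiple of log d, which is all that k <=
    log d + 2 requires. *)
Let l3_ge : l / 4 <= l ^+ 3.
Proof.
have -> : l ^+ 3 = l * l ^+ 2 by rewrite exprS.
rewrite ler_wpM2l //; first by rewrite (le_trans _ l_ge).
have -> : 4^-1 = (1 / 2) ^+ 2 :> R by field.
by rewrite lerXn2r ?nnegrE // (le_trans _ l_ge).
Qed.

Lemma hess_batch_gt0 : (0 < bh)%N.
Proof.
apply: rounding_ge_nat bh_round _.
have m4 : 4 <= Num.max 4 (n%:R `^ (2 / 5)) :> R by rewrite le_max lexx.
set m := Num.max _ _ in m4 *.
have l3 : 1 / 8 <= l ^+ 3 by have := l_ge; have := l3_ge; lra.
have m0 : 0 <= m by lra.
have := ler_pM (ler0n R 4) (_ : 0 <= 1 / 8) m4 l3.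
by move=> /(_ (divr_ge0 ler01 (ler0n R 8))); lra.
Qed.

Lemma epoch_length_pow4 : (T ^ 4 <= 4 * bg)%N.
Proof.
rewrite -(ler_nat R) natrX natrM.
have := rounding_gt bg_round; rewrite fifth_root_pow4.
have T0 : 0 <= T%:R :> R by [].
case: epoch_length_le => -[p2 Tle].
  have : T%:R ^+ 4 <= 3 ^+ 4 :> R by rewrite lerXn2r ?nnegrE.
  have : (2 ^+ 4 : R) <= Num.max (p ^+ 4) (2 ^+ 4) by rewrite le_max lexx orbT.
  by set m := Num.max _ _; lra.
have : T%:R ^+ 4 <= (3 / 2 * p) ^+ 4 by rewrite lerXn2r ?nnegrE // mulr_ge0 ?powR_ge0.
have : 2 ^+ 4 <= p ^+ 4 by rewrite lerXn2r ?nnegrE ?powR_ge0.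
have : p ^+ 4 <= Num.max (p ^+ 4) (2 ^+ 4) by rewrite le_max lexx.
by set m := Num.max _ _; lra.
Qed.

(** With m the maximum in b_h, the left side is at most 36 (l + 2) m <= 180 l m, as l >= 1/2, while
    3000 m l^3 >= 750 m l; the gap covers rounding. *)
Lemma epoch_length_sqr k : k%:R <= l + 2 -> (16 * k * T ^ 2 <= bh)%N.
Proof.
move=> kl; rewrite -(ler_nat R) natrM natrX natrM.
have := rounding_gt bh_round; rewrite fifth_root_pow2.
set m := Num.max _ _ => Hb.
have [m4 mp] : 4 <= m /\ p ^+ 2 <= m by rewrite !le_max !lexx orbT.
have T2 : T%:R ^+ 2 <= 9 / 4 * m.
  have T0 : 0 <= T%:R :> R by [].
  case: epoch_length_le => -[p2 Tle].
    have : T%:R ^+ 2 <= 3 ^+ 2 :> R by rewrite lerXn2r ?nnegrE.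
    by lra.
  have : T%:R ^+ 2 <= (3 / 2 * p) ^+ 2 by rewrite lerXn2r ?nnegrE // mulr_ge0 ?powR_ge0.
  by lra.
have kT := ler_pM (ler0n R k) (sqr_ge0 T%:R) kl T2.
have m0 : 0 <= m by lra.
have ml3 := ler_wpM2l m0 l3_ge; have ml := ler_wpM2l m0 l_ge.
by lra.
Qed.

(** With p = n^(1/5), T b_g is of order p^5 = n and T b_h of order p^3 log^3 d, so an epoch costs as
    much as a full pass up to logarithms. The factors 2 count the queries at the iterate and at the
    snapshot. *)
Lemma epoch_cost_le :
  n%:R + T%:R * (2 * bg%:R + 2 * bh%:R) <= 79 * 1000 * (n%:R * (1 + l) ^+ 3).
Proof.
have p1 := fifth_root_ge1; have p0 : 0 <= p by lra.
set q := (1 + l) ^+ 3.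
have l0 : 0 <= l by rewrite (le_trans _ l_ge).
have l3q : l ^+ 3 <= q by rewrite lerXn2r ?nnegrE ?addr_ge0 // lerDr.
have q1 : 1 <= q by rewrite exprn_ege1 // lerDl.
have q0 : 0 <= q by lra.
have p_ge1 m : 1 <= p ^+ m by rewrite exprn_ege1.
have Tle : T%:R <= 3 * p by case: epoch_length_le => -[]; lra.
have bgle : bg%:R <= 81 * p ^+ 4.
  have := rounding_le bg_round; rewrite fifth_root_pow4.
  have : Num.max (p ^+ 4) (2 ^+ 4) <= 16 * p ^+ 4.
    by rewrite ge_max; have := p_ge1 4%N; lra.
  by have := p_ge1 4%N; set m := Num.max _ _; lra.
have bhle : bh%:R <= 13 * 1000 * (p ^+ 2 * q).
  have := rounding_le bh_round; rewrite fifth_root_pow2.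
  have m4 : Num.max 4 (p ^+ 2) <= 4 * p ^+ 2.
    by rewrite ge_max; have := p_ge1 2%N; lra.
  have m0 : 0 <= Num.max 4 (p ^+ 2) by rewrite le_max ler0n.
  have := ler_pM m0 (exprn_ge0 3 l0) m4 l3q.
  have := ler_pM ler01 ler01 (p_ge1 2%N) q1.
  by set m := Num.max _ _; lra.
have sum_le : 2 * bg%:R + 2 * bh%:R <= 162 * p ^+ 4 + 26 * 1000 * (p ^+ 2 * q) by lra.
have sum_ge0 : 0 <= 2 * bg%:R + 2 * bh%:R :> R by rewrite addr_ge0 // mulr_ge0.
have := ler_pM (ler0n R T) sum_ge0 Tle sum_le.
have Nq : n%:R * q = p ^+ 5 * q by rewrite fifth_root_pow5.
have N5 : n%:R = p ^+ 5 by rewrite fifth_root_pow5.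
have : p ^+ 5 <= p ^+ 5 * q by rewrite ler_peMr // exprn_ge0.
have : p ^+ 3 * q <= p ^+ 5 * q.
  by rewrite ler_wpM2r // (ler_weXn2l p1).
by have := p_ge1 5%N; rewrite Nq; lra.
Qed.

End ParameterBounds.

(** * Query count, and passage from the moment 3/2 to the first moment *)

Lemma size_flatten_const (A : eqType) (ss : seq (seq A)) m :
  (forall s, s \in ss -> size s = m) -> size (flatten ss) = (size ss * m)%N.
Proof.
elim: ss => [//|s ss IH] H; rewrite size_cat (H s) ?mem_head // mulSn IH //.
by move=> s' s's; apply: H; rewrite inE s's orbT.
Qed.

Lemma size_oracle_queries (R : realType) d n S T bg bh
    (x : batches n S T bg bh -> nat -> nat -> 'rV[R]_d) w :
  size (oracle_queries x w) = (S * (n + T * (bg + (bg + (bh + bh)))))%N.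
Proof.
rewrite /oracle_queries (@size_flatten_const _ _ (n + T * (bg + (bg + (bh + bh))))).
  by rewrite size_map size_enum_ord.
move=> _ /mapP[s _ ->]; rewrite size_cat size_map size_enum_ord.
rewrite (@size_flatten_const _ _ (bg + (bg + (bh + bh)))).
  by rewrite size_map size_enum_ord.
by move=> _ /mapP[t _ ->]; rewrite !size_cat !size_map !size_tuple.
Qed.

(** Jensen through the tangent line of y^(3/2) at y = eps; in terms of square roots the gap is (z -
    r)^2 (2 z + r) / (3 r). *)
Lemma powR_expect_le (R : realType) d n S T bg bh
    (x : batches n S T bg bh -> nat -> nat -> 'rV[R]_d)
    (g phi : 'rV[R]_d -> R) (eps : R) : 0 < eps -> (0 < n)%N -> (0 < S)%N -> (0 < T)%N ->
  (forall y, 0 <= g y) -> (forall y, g y `^ (3 / 2) <= phi y) ->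
  expect_out x phi <= eps `^ (3 / 2) -> expect_out x g <= eps.
Proof.
move=> eps0 n0 S0 T0 g0 gphi; rewrite powR32 ?(ltW eps0) //.
set r := Num.sqrt eps; have r0 : 0 < r by rewrite sqrtr_gt0.
have r2 : r ^+ 2 = eps by rewrite sqr_sqrtr // ltW.
move=> H.
apply: (@le_trans _ _ (expect_out x (fun y => 2 / (3 * r) * phi y + r ^+ 2 / 3))).
  apply: ler_mean => o; set y := x _ _ _.
  apply: (@le_trans _ _ (2 / (3 * r) * g y `^ (3 / 2) + r ^+ 2 / 3)); last first.
    by rewrite lerD2r ler_wpM2l // divr_ge0 // mulr_ge0 // ltW.
  rewrite powR32 //; set z := Num.sqrt (g y); have z0 : 0 <= z := sqrtr_ge0 _.
  have -> : g y = z ^+ 2 by rewrite sqr_sqrtr.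
  rewrite -subr_ge0.
  have -> : 2 / (3 * r) * z ^+ 3 + r ^+ 2 / 3 - z ^+ 2
          = (z - r) ^+ 2 * (2 * z + r) / (3 * r).
    by field; rewrite gt_eqF.
  apply: divr_ge0; last by rewrite mulr_ge0 // ltW.
  by apply: mulr_ge0; [exact: sqr_ge0 | lra].
rewrite /expect_out meanD meanZ mean_cst; last first.
  rewrite !card_prod !card_ord card_ffun !card_prod !card_ord !card_tuple card_ord.
  by rewrite !muln_gt0 !expn_gt0 muln_gt0 !expn_gt0 n0 S0 T0.
have c0 : 0 <= 2 / (3 * r) by rewrite divr_ge0 // mulr_ge0 // ltW.
have := ler_wpM2l c0 H; rewrite -r2.
have -> : 2 / (3 * r) * r ^+ 3 = 2 / 3 * r ^+ 2 by field; rewrite gt_eqF.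
by rewrite /expect_out; lra.
Qed.

(** * Assembly of the error bound and the complexity bound *)

Theorem theorem4p9 :
  exists C k : nat,
  forall (R : realType) (d n : nat) (f : 'I_n -> 'rV[R]_d -> R)
    (L2 Delta eps : R) (T S bg bh : nat)
    (x : batches n S T bg bh -> nat -> nat -> 'rV[R]_d),
  let C_M : R := 150 in
  let M : R := C_M * L2 in
  let F := objective f in
  (2 <= d)%N -> (0 < n)%N -> 0 < L2 -> 0 < Delta -> 0 < eps ->
  third_moment_smooth f L2 ->
  initial_gap f 0 Delta ->
  rounding T (Num.max 2 (n%:R `^ (1 / 5)) : R) ->
  rounding S (Num.max 1 (240 * C_M ^+ 2 * L2 `^ (1 / 2) * Delta
                         * n%:R `^ (- (1 / 5)) * eps `^ (- (3 / 2)))) ->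
  rounding bg (5 * Num.max (n%:R `^ (4 / 5)) (2 ^+ 4) : R) ->
  rounding bh (3000 * Num.max 4 (n%:R `^ (2 / 5)) * ln d%:R ^+ 3 : R) ->
  SVRC_run f M 0 x ->
  [/\ forall w, (size (oracle_queries x w))%:R
        <= C%:R * log_factor d n eps ^+ k
           * (n%:R + Delta * Num.sqrt L2 * n%:R `^ (4 / 5) / eps `^ (3 / 2)),
      expect_out x (fun y => Num.max (enorm (grad F y) `^ (3 / 2))
                       (- (lambda_min (hess F y) ^+ 3 / L2 `^ (3 / 2))))
        <= eps `^ (3 / 2)
    & expect_out x (fun y => enorm (grad F y)) <= eps].
Proof.
(* The exponent 3 comes from log^3 d in b_h; 10^12 exceeds 79000 * 240 * 150^2, the coefficient
   reached at the end. *)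
exists (1000 ^ 4)%N, 3%N => R d n f L2 Delta eps T S bg bh x C_M M F.
move=> d2 n0 L0 Delta0 eps0 smooth gap Tr Sr bgr bhr run.
have p1 := @fifth_root_ge1 R _ n0; have p5 := @fifth_root_pow5 R n.
have p4 := @fifth_root_pow4 R n.
set p := n%:R `^ (1 / 5) in p1 p5 p4.
have p0 : 0 < p by exact: lt_le_trans ltr01 p1.
set E := eps `^ (3 / 2); have E0 : 0 < E by rewrite powR_gt0.
set sL := Num.sqrt L2; have sL0 : 0 < sL by rewrite sqrtr_gt0.
pose A := 240 * 150 ^+ 2 * sL * Delta / p / E.
have A0 : 0 < A.
  apply: (divr_gt0 _ E0); apply: (divr_gt0 _ p0); apply: (mulr_gt0 _ Delta0).
  by apply: (mulr_gt0 _ sL0); lra.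
have {}Sr : rounding S (Num.max 1 A).
  move: Sr; rewrite !powRN -/p -/E (_ : L2 `^ (1 / 2) = sL) //.
  by rewrite (_ : 1 / 2 = 2^-1); [exact: powR12_sqrt (ltW L0) | field].
have S0 : (0 < S)%N by apply: rounding_ge_nat Sr _; rewrite le_max lexx.
have T2 := epoch_length_ge2 Tr; have T0 : (0 < T)%N by exact: leq_trans T2.
have [k [k1 dk kl]] := @exists_pow4_ge R d d2.
have expectation : expect_out x (fun y => Num.max (enorm (grad F y) `^ (3 / 2))
    (- (lambda_min (hess F y) ^+ 3 / L2 `^ (3 / 2)))) <= E.
  apply: (le_trans (svrc_expectation_bound n0 L0 smooth S0 T0
    (grad_batch_gt0 bgr) (hess_batch_gt0 d2 bhr) k1 dk
    (epoch_length_pow4 Tr bgr) (epoch_length_sqr d2 Tr bhr kl)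
    (initial_gap_le gap) run)).
  rewrite -/sL ler_pdivrMr ?mulr_gt0 ?ltr0n //.
  (* A < S + 1 by rounding, and S >= 1. *)
  have SA : A <= 2 * S%:R.
    have := rounding_gt Sr; rewrite gt_max => /andP[_].
    have : 1 <= S%:R :> R by rewrite ler1n.
    by lra.
  have TA := epoch_length_ge Tr; rewrite -/p in TA.
  (* A p <= 4 S T, and E A p = 5400000 sL Delta is far above the required 4 * 54000 sL Delta. *)
  have := ler_pM (ltW A0) (ltW p0) SA TA.
  move=> /(ler_wpM2l (ltW E0)).
  have -> : E * (A * p) = 240 * 150 ^+ 2 * (sL * Delta).
    by rewrite /A; field; rewrite !gt_eqF.
  have : 0 < sL * Delta by rewrite mulr_gt0.
  by lra.
split=> //; last first.
  apply: powR_expect_le eps0 n0 S0 T0 _ _ expectation => y; first exact: enorm_ge0.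
  by rewrite le_max lexx.
move=> w; rewrite size_oracle_queries natrM natrD natrM !natrD.
have cost := epoch_cost_le d2 n0 Tr bgr bhr.
set q := log_factor d n eps.
have l0 : 0 <= ln d%:R :> R by rewrite (le_trans _ (ln_nat_ge_half d2)).
have qle : (1 + ln d%:R) ^+ 3 <= q ^+ 3.
  have ln0 : 0 <= ln n%:R :> R by rewrite ln_ge0 // ler1n.
  have leps0 : 0 <= ln (1 + eps^-1) by rewrite ln_ge0 // lerDl invr_ge0 ltW.
  rewrite lerXn2r ?nnegrE ?addr_ge0 ?mulr_ge0 ?addr_ge0 //.
  rewrite /q /log_factor -mulrA ler_peMr ?addr_ge0 //.
  by rewrite -[1 in leLHS]mulr1 ler_pM // lerDl.
have q0 : 0 <= q ^+ 3 by apply: le_trans qle; rewrite exprn_ge0 ?addr_ge0.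
rewrite p4 natrX -/sL -/E.
have N0 : 0 <= n%:R :> R by [].
have Sle : S%:R <= 2 + A.
  by have := rounding_le Sr; case: (leP 1 A) => _; lra.
have {}cost : n%:R + T%:R * (bg%:R + (bg%:R + (bh%:R + bh%:R)))
    <= 79 * 1000 * (n%:R * q ^+ 3).
  have := ler_wpM2l N0 qle; lra.
have cost0 : 0 <= n%:R + T%:R * (bg%:R + (bg%:R + (bh%:R + bh%:R))) :> R.
  by rewrite addr_ge0 // mulr_ge0 // !addr_ge0.
apply: (le_trans (ler_pM (ler0n R S) cost0 Sle cost)).
pose Q := Delta * sL * p ^+ 4 / E.
have Q0 : 0 <= Q by rewrite divr_ge0 ?(ltW E0) // !mulr_ge0 ?exprn_ge0 // ltW.
(* The factor 1 / p in A turns n = p^5 into p^4 = n^(4/5); the 2 in S <= 2 + A accounts for the term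
   n of the complexity. *)
have AN : A * n%:R = 240 * 150 ^+ 2 * Q.
  by rewrite -p5 /A /Q; field; rewrite !gt_eqF.
rewrite -/Q.
have -> : (2 + A) * (79 * 1000 * (n%:R * q ^+ 3))
    = q ^+ 3 * (79 * 1000 * (2 * n%:R + A * n%:R)) by ring.
rewrite [1000 ^+ 4 * _]mulrC -[leRHS]mulrA ler_wpM2l // AN.
by lra.
Qed.
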